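(* Suppose $\Pi_{PIR}^{(1)}$ and $\Pi_{PIR}^{(2)}$ are computationally private PIR schemes on the index database $DB$ and the embedding (vector) database $DB_{\mathsf{Emb}}$ respectively. Then the two-round PILLAR-Bin protocol (described in the context, with first-round PIR queries made with $\Pi_{PIR}^{(1)}$ and second-round PIR queries made with $\Pi_{PIR}^{(2)}$) is secure against a semi-honest server.
   Context: **PIR.** A single-server PIR (private information retrieval) scheme $(\mathsf{Query},\mathsf{Answer},\mathsf{Decode})$ over a database $DB$ of $n$ records is *computationally private* if, with $\lambda$ the security parameter: (1) correctness: for any index $i\in[n]$, $\Pr[\mathsf{Decode}(\mathsf{Answer}(DB,\mathsf{Query}(i)))=DB[i]]\ge 1-\mathsf{negl}(\lambda)$; (2) privacy: for all indices $i,j\in[n]$ and all PPT distinguishers $\mathcal D$, $|\Pr[\mathcal D(\mathsf{Query}(i))=1]-\Pr[\mathcal D(\mathsf{Query}(j))=1]|\le\mathsf{negl}(\lambda)$. PIR is used with a preprocessing phase, run between server and client before any query, in which the client initializes a private state. A batched PIR query packs several indices into a single query. **Security.** A semi-honest server follows the protocol but tries to learn about the client's query. Security is defined via the standard simulation paradigm: there is a PPT simulator that, given only the public parameters (including $\lambda$ and the fixed batch sizes $\beta,\beta'$), produces an output computationally indistinguishable from the server's view in a real execution, for every client query $Q$. The server performs the construction of the databases itself and knows them in full; during retrieval its view consists solely of the $\beta$ PIR queries $\mathsf{Query}^{(1)}(r_i)$, $i=1,\dots,\beta$, for the row indices in the first batch, and the $\beta'$ PIR queries $\mathsf{Query}^{(2)}(\zeta_i)$,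 $i=1,\dots,\beta'$, for the document indices in the second batch. **Public parameters.** A corpus $\mathcal C=\{D_1,\dots,D_N\}$ of documents, each with an index $\mathsf{id}(D)$; an analyzer $\mathsf{Analyze}$ mapping text to a finite sequence of terms; the vocabulary $\mathcal V=\bigcup_{D\in\mathcal C}\mathsf{Analyze}(D)$; an embedding function $\mathsf{Emb}$ mapping text to $\mathbb R^d$; the parameters $(k_1,b)$ of the BM25 lexical scoring function; a row count $R$; a row depth $t$; a hash function $H:\mathcal V\to\{0,\dots,R-1\}$; batch bounds $\beta$ and $\beta'$; an output size $k$; a reserved dummy index $\bot$. **Two-round PILLAR-Bin protocol.** The client's input is a query $Q$ with $\mathsf{Analyze}(Q)=(w_1,\dots,w_{|Q|})$. *Preprocessing (server).* The server initializes an empty database $DB$ of $R$ rows. For each $w\in\mathcal V$ it scores every $D\in\mathcal C$ containing $w$ under BM25 with $w$ as a single-term query, and lets $\mathcal L_w$ be the list of the $t$ highest-scoring documents in descending order, padded with dummy entries of index $\bot$ if fewer than $t$ documents contain $w$. For each row $z$, let $w^{(1)},\dots,w^{(m_z)}$ be the terms $w\in\mathcal V$ with $H(w)=z$, in an arbitrary fixed order. The server fills row $z$ round-robin: the $j$-th document of $\mathcal L_{w^{(i)}}$ goes to position $(j-1)m_z+i$. For every row $z$ and every offset $x$ with $0<x\le t$ it replaces the document $D=DB[z][x]$ by its index $\mathsf{id}(D)$ alone, so that $DB$ consists of $R$ rows of $t$ indices each. It also builds a database $DB_{\mathsf{Emb}}$ of $N$ rows, row $j$ holding $\mathsf{Emb}(D_j)$.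 Finally the server runs the PIR preprocessing phase over $DB$ and over $DB_{\mathsf{Emb}}$ with the client, who stores the resulting private states. *Retrieval.* (Round 1) The client computes $\mathsf{Analyze}(Q)$ and the row indices $r_i=H(w_i)$ for $i\le|Q|$, removing repeated indices. It fixes the batch to exactly $\beta$ indices: if $|Q|>\beta$ it retains the first $\beta$; if $|Q|<\beta$ it pads with random indices from $\{0,\dots,R-1\}$. It sends one batched PIR query to $DB$ and recovers $\beta$ rows of indices. Locally, it discards $\bot$ and duplicate indices, obtaining a set $I$ of at most $\beta t$ distinct document indices. (Round 2) The client fixes $I$ to exactly $\beta'$ indices: if $|I|>\beta'$ it retains the first $\beta'$; if $|I|<\beta'$ it appends indices drawn randomly from $\{1,\dots,N\}$. It sends a single batched PIR query for these $\beta'$ indices to $DB_{\mathsf{Emb}}$ and recovers the corresponding embeddings. Locally, it computes $\mathsf{Emb}(Q)$, ranks the documents of $I$ by cosine similarity to $\mathsf{Emb}(Q)$ (ignoring the embeddings returned for padding indices), and outputs the $k$ document indices of highest similarity. No other message passes from the client to the server during retrieval.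
   Formalization: Each PIR query in a batch uses its own independently generated preprocessing state; if one private state were shared by all queries of a batch, the stated single-query privacy would not imply security (e.g. a one-time-pad shift of the index reused for two queries). *)

(* Defs.v *)
(* MathComp / MathComp-Analysis. *)
From HB Require Import structures.
From mathcomp Require Import all_boot all_order all_algebra.
From mathcomp Require Import reals exp.

Set Implicit Arguments.
Unset Strict Implicit.
Unset Printing Implicit Defensive.

Import Order.TTheory GRing.Theory Num.Theory.
Local Open Scope ring_scope.

(* Finite distributions as lists of (weight, outcome). The outcome type carries
   no structure, and outcomes may be repeated: only dpr gives meaning to a
   list. All distributions below are built from dret, dbind, fair coins and
   uniform choices, so rational weights suffice. *)
Definition dist (T : Type) : Type := seq (rat * T).

Definition dret T (x : T) : dist T := [:: (1, x)].

Definition dbind S T (m : dist S) (f : S -> dist T) : dist T :=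
  flatten [seq [seq (p.1 * q.1, q.2) | q <- f p.2] | p <- m].

Notation "'let*' x ':=' m 'in' k" := (dbind m (fun x => k))
  (at level 200, x name, m at level 200, k at level 200, right associativity).

Definition dmap S T (f : S -> T) (m : dist S) : dist T :=
  let* x := m in dret (f x).

Definition dcoin : dist bool := [:: (2^-1, false); (2^-1, true)].

Definition duniform (T : finType) : dist T :=
  [seq (#|T|%:R^-1, x) | x <- enum T].

(* n independent samples, the i-th one from f i *)
Fixpoint dtuple T (n : nat) : ('I_n -> dist T) -> dist (n.-tuple T) :=
  match n with
  | 0 => fun _ => dret [tuple]
  | n'.+1 => fun f =>
      let* x := f ord0 in
      let* s := dtuple (fun i => f (lift ord0 i)) in
      dret [tuple of x :: s]
  end.

Definition dpr T (m : dist T) (E : pred T) : rat := \sum_(p <- m | E p.2) p.1.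

(* Probabilistic multi-stack machines with structured control: a register is a
   stack of bits, every instruction inspects or changes the top of a single
   register at unit cost, and Flip pushes a fair random bit. A program uses
   finitely many registers, hence is a probabilistic multi-tape Turing machine
   (half-tapes as stacks), and conversely, up to a constant factor in time. *)
Definition bits := seq bool.

Inductive cmd : Type :=
| Skip
| Seq of cmd & cmd
| Push of nat & bool
| Pop of nat
| Flip of nat
| Case of nat & cmd & cmd & cmd  (* top of register: none / false / true *)
| While of nat & cmd.            (* loop while the register is nonempty *)

Definition store := nat -> bits.

Definition upd (s : store) (x : nat) (v : bits) : store :=
  fun y => if y == x then v else s y.

(* The command list is the continuation; the machine has halted when it is
   empty. *)
Definition config : Type := (seq cmd * store)%type.

Definition step (c : config) : dist config :=
  let: (k, s) := c in
  match k with
  | [::] => dret ([::], s)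
  | Skip :: k' => dret (k', s)
  | Seq c1 c2 :: k' => dret ([:: c1, c2 & k'], s)
  | Push x b :: k' => dret (k', upd s x (b :: s x))
  | Pop x :: k' => dret (k', upd s x (behead (s x)))
  | Flip x :: k' => dmap (fun b => (k', upd s x (b :: s x))) dcoin
  | Case x c0 cf ct :: k' =>
      dret ((match s x with
             | [::] => c0 | false :: _ => cf | true :: _ => ct
             end) :: k', s)
  | While x c :: k' =>
      dret (if s x is [::] then k' else [:: c, While x c & k'], s)
  end.

Fixpoint steps (n : nat) (c : config) : dist config :=
  if n is n'.+1 then let* c' := step c in steps n' c' else dret c.

(* The i-th input is placed in register i; all other registers are empty. *)
Definition init (c : cmd) (ins : seq bits) : config :=
  ([:: c], fun x => nth [::] ins x).

Definition input_size (ins : seq bits) : nat := sumn (map size ins).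

Record ppt : Type := Ppt {
  ppt_code : cmd;
  ppt_time : {poly nat};
  ppt_halts : forall ins : seq bits,
    all (fun p => nilp p.2.1)
        (steps (ppt_time.[input_size ins]) (init ppt_code ins))
}.

Definition eval (A : ppt) (ins : seq bits) : dist store :=
  dmap snd (steps ((ppt_time A).[input_size ins]) (init (ppt_code A) ins)).

Definition unary (n : nat) : bits := nseq n true.

Definition negligible (f : nat -> rat) : Prop :=
  forall c : nat, exists n0 : nat, forall n : nat,
    (n0 < n)%N -> `|f n| < n%:R ^- c.

(* Probability that the distinguisher A, given 1^lam and a sample of m (spread
   over its next input registers), outputs 1. *)
Definition accept_pr (A : ppt) (lam : nat) (m : dist (seq bits)) : rat :=
  dpr (let* v := m in eval A (unary lam :: v)) (fun s => s 0 == [:: true]).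

(* Single-server PIR with preprocessing, for n records of type Rec:
   - pir_prep DB, on 1^lam, leaves the client's private state in register 0;
   - pir_query, on 1^lam, a private state and 1^i, leaves the query in
     register 0 and the client's secret for that query in register 1;
   - pir_answer DB, on 1^lam and a query, leaves the answer in register 0;
   - pir_decode, on 1^lam, the private state, the secret and the answer, leaves
     in register 0 a code that pir_read interprets as a record.
   Records need not be finitely representable (they may be real vectors), so
   the two server-side algorithms are families indexed by the database. *)
Record pir (n : nat) (Rec : eqType) : Type := Pir {
  pir_prep : ('I_n -> Rec) -> ppt;
  pir_query : ppt;
  pir_answer : ('I_n -> Rec) -> ppt;
  pir_decode : ppt;
  pir_read : bits -> Rec
}.

Section PIR.
Variables (n : nat) (Rec : eqType) (P : pir n Rec) (DB : 'I_n -> Rec).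

Definition prep (lam : nat) : dist bits :=
  dmap (fun s => s 0) (eval (pir_prep P DB) [:: unary lam]).

Definition query (lam : nat) (st : bits) (i : 'I_n) : dist (bits * bits) :=
  dmap (fun s => (s 0, s 1)) (eval (pir_query P) [:: unary lam; st; unary i]).

Definition answer (lam : nat) (q : bits) : dist bits :=
  dmap (fun s => s 0) (eval (pir_answer P DB) [:: unary lam; q]).

Definition decode (lam : nat) (st sec a : bits) : dist Rec :=
  dmap (fun s => pir_read P (s 0))
       (eval (pir_decode P) [:: unary lam; st; sec; a]).

Definition retrieve (lam : nat) (i : 'I_n) : dist Rec :=
  let* st := prep lam in
  let* q := query lam st i in
  let* a := answer lam q.1 in
  decode lam st q.2 a.

Definition query_message (lam : nat) (i : 'I_n) : dist bits :=
  let* st := prep lam in dmap fst (query lam st i).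

Definition pir_correct : Prop :=
  forall i : 'I_n, exists2 eps : nat -> rat, negligible eps &
    forall lam : nat, 1 - eps lam <= dpr (retrieve lam i) (fun r => r == DB i).

Definition pir_private : Prop :=
  forall (i j : 'I_n) (A : ppt), exists2 eps : nat -> rat, negligible eps &
    forall lam : nat,
      `| accept_pr A lam (dmap (fun q => [:: q]) (query_message lam i))
       - accept_pr A lam (dmap (fun q => [:: q]) (query_message lam j)) |
      <= eps lam.

Definition computationally_private : Prop := pir_correct /\ pir_private.

End PIR.

(* Documents, rows and positions are numbered from 0. *)
Record pillar_params (R : realType) : Type := PillarParams {
  text : eqType;
  term : eqType;
  ndocs : nat;
  corpus : 'I_ndocs -> text;
  doc_id : text -> 'I_ndocs;
  analyze : text -> seq term;
  emb_dim : nat;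
  emb : text -> 'rV[R]_emb_dim;
  bm25_k1 : R;
  bm25_b : R;
  nrows : nat;
  depth : nat;
  (* total on terms, since the client also hashes query terms that may occur in
     no document *)
  hash : term -> 'I_nrows;
  (* the arbitrary fixed order of the vocabulary terms within each row *)
  row_terms : 'I_nrows -> seq term;
  batch1 : nat;
  batch2 : nat;
  out_size : nat;
  ndocs_gt0 : (0 < ndocs)%N;
  nrows_gt0 : (0 < nrows)%N;
  doc_idK : cancel corpus doc_id;
  row_terms_uniq : forall z, uniq (row_terms z);
  mem_row_terms : forall z w, (w \in row_terms z) =
    [exists j, w \in analyze (corpus j)] && (hash w == z)
}.

(* mathcomp's undup keeps last occurrences; this keeps first ones. *)
Definition dedup (T : eqType) (s : seq T) : seq T := rev (undup (rev s)).

(* Truncation to the first b entries, or padding by independent uniform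
   indices; the unused draws are discarded. *)
Definition fix_batch (n b : nat) (s : seq 'I_n) : dist (b.-tuple 'I_n) :=
  let* u := dtuple (fun _ : 'I_b => duniform 'I_n) in
  dret [tuple nth (tnth u i) s i | i < b].

Section Pillar.
Variables (R : realType) (pp : pillar_params R).

Definition doc_freq (w : term pp) : nat :=
  #|[pred j : 'I_(ndocs pp) | w \in analyze (corpus j)]|.

Definition doc_len (D : text pp) : R := (size (analyze D))%:R.

Definition avg_len : R := (\sum_j doc_len (corpus j)) / (ndocs pp)%:R.

(* The inverse document frequency is common to all documents, so for a
   single-term query its exact (positive) variant does not affect the
   ranking. *)
Definition idf (w : term pp) : R :=
  ln (1 + ((ndocs pp)%:R - (doc_freq w)%:R + 2^-1) / ((doc_freq w)%:R + 2^-1)).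

Definition bm25 (ws : seq (term pp)) (D : text pp) : R :=
  \sum_(w <- ws)
    let tf : R := (count_mem w (analyze D))%:R in
    idf w * (tf * (bm25_k1 pp + 1)) /
      (tf + bm25_k1 pp * (1 - bm25_b pp + bm25_b pp * (doc_len D / avg_len))).

(* The list of a term, padded by None (the dummy entry) to length depth pp; the
   sort is stable, so ties are broken by document number. *)
Definition postings (w : term pp) : seq (option (text pp)) :=
  let docs := [seq D <- [seq corpus j | j <- enum 'I_(ndocs pp)]
                 | w \in analyze D] in
  let ranked := sort (fun D D' => bm25 [:: w] D' <= bm25 [:: w] D) docs in
  mkseq (nth None (map Some ranked)) (depth pp).

(* Round-robin filling: the j-th entry of the list of the i-th term comes at
   (0-based) position j * m + i, m being the number of terms of the row. *)
Definition filled_row (z : 'I_(nrows pp)) : seq (option (text pp)) :=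
  [seq nth None (postings w) j | j <- iota 0 (depth pp), w <- row_terms z].

Definition index_row : eqType := (depth pp).-tuple (option 'I_(ndocs pp)).

(* Rows to which no term is hashed consist of dummy indices. *)
Definition index_db (z : 'I_(nrows pp)) : index_row :=
  [tuple omap (@doc_id R pp) (nth None (filled_row z) x) | x < depth pp].

Definition emb_db (j : 'I_(ndocs pp)) : 'rV[R]_(emb_dim pp) := emb (corpus j).

Definition cosine (u v : 'rV[R]_(emb_dim pp)) : R :=
  (u *m v^T) 0 0 /
    (Num.sqrt ((u *m u^T) 0 0) * Num.sqrt ((v *m v^T) 0 0)).

Definition row_indices (Q : text pp) : seq 'I_(nrows pp) :=
  dedup [seq hash w | w <- analyze Q].

Definition doc_indices (rows : seq index_row) : seq 'I_(ndocs pp) :=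
  dedup (pmap id (flatten [seq tval r | r <- rows])).

(* es lists the embeddings of the first batch2 pp entries of I, followed by
   those of the padding indices, which zip drops. *)
Definition rank_output (Q : text pp) (I : seq 'I_(ndocs pp))
    (es : seq 'rV[R]_(emb_dim pp)) : seq 'I_(ndocs pp) :=
  let ranked := sort (fun x y => cosine (emb Q) y.2 <= cosine (emb Q) x.2)
                     (zip I es) in
  take (out_size pp) (map fst ranked).

Definition view : Type :=
  ((batch1 pp).-tuple bits * (batch2 pp).-tuple bits)%type.

Variables (P1 : pir (nrows pp) index_row)
          (P2 : pir (ndocs pp) 'rV[R]_(emb_dim pp)).

(* Joint distribution of the server's view and the client's output. The PIR
   preprocessing provides the client with one private state per query of each
   batch: privacy of a PIR scheme concerns a single query, so a state is not
   reused. *)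
Definition execution (lam : nat) (Q : text pp) :
    dist (view * seq 'I_(ndocs pp)) :=
  let* st1 := dtuple (fun _ : 'I_(batch1 pp) => prep P1 index_db lam) in
  let* st2 := dtuple (fun _ : 'I_(batch2 pp) => prep P2 emb_db lam) in
  let* r := fix_batch (batch1 pp) (row_indices Q) in
  let* q1 := dtuple (fun i => query P1 lam (tnth st1 i) (tnth r i)) in
  let* a1 := dtuple (fun i => answer P1 index_db lam (tnth q1 i).1) in
  let* rows := dtuple (fun i =>
    decode P1 lam (tnth st1 i) (tnth q1 i).2 (tnth a1 i)) in
  let* zeta := fix_batch (batch2 pp) (doc_indices rows) in
  let* q2 := dtuple (fun i => query P2 lam (tnth st2 i) (tnth zeta i)) in
  let* a2 := dtuple (fun i => answer P2 emb_db lam (tnth q2 i).1) in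
  let* es := dtuple (fun i =>
    decode P2 lam (tnth st2 i) (tnth q2 i).2 (tnth a2 i)) in
  dret ((map_tuple fst q1, map_tuple fst q2),
        rank_output Q (doc_indices rows) es).

Definition server_view (lam : nat) (Q : text pp) : dist view :=
  dmap fst (execution lam Q).

(* A simulator gets 1^lam only: the other public parameters are fixed, so its
   code may depend on them. The simulated queries are read off its first
   batch1 pp + batch2 pp registers. *)
Definition simulated_view (S : ppt) (lam : nat) : dist view :=
  dmap (fun s : store => ([tuple s i | i < batch1 pp],
                          [tuple s (batch1 pp + i)%N | i < batch2 pp]))
       (eval S [:: unary lam]).

Definition view_bits (v : view) : seq bits := v.1 ++ v.2.

Definition secure_semi_honest : Prop :=
  exists S : ppt, forall A : ppt, exists2 eps : nat -> rat, negligible eps &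
    forall (Q : text pp) (lam : nat),
      `| accept_pr A lam (dmap view_bits (server_view lam Q))
       - accept_pr A lam (dmap view_bits (simulated_view S lam)) |
      <= eps lam.

End Pillar.

(* Main.v *)
(* The second batch depends on the answers of the first round, but by
   correctness of the first scheme the recovered rows are, up to a negligible
   probability, the rows of the index database; both batches are then functions
   of the query and of the padding. For fixed batches the view consists of
   independent single PIR queries, and a hybrid argument exchanges their indices
   for index 0 one by one. The number of index vectors is finite and independent
   of the query, hence so is the total error. The simulator queries index 0
   throughout; it and the hybrid reductions have to be actual machines, which
   run the given programs in disjoint sets of registers. *)
Require Import Defs.
From mathcomp Require Import all_boot all_order all_algebra.
From mathcomp Require Import reals.
From mathcomp Require boolp.
From mathcomp Require Import zify lra ring.
From Stdlib Require List.

Set Implicit Arguments.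
Unset Strict Implicit.
Unset Printing Implicit Defensive.

Import Order.TTheory GRing.Theory Num.Theory.

(** * Finite distributions *)

Arguments dbind : simpl never.

Section Monad.
Local Open Scope ring_scope.
Variables S T : Type.
Implicit Types (m : dist S) (f : S -> dist T).

(** Two obstacles shape the development. A [ppt] comes with a clock that is certified on initial
    stores, whereas a reduction runs given machines in stores reached midway, and random branches
    finish at different times. Behaviour and cost are therefore kept apart: [wp] says what a program
    computes in some unspecified number of steps, [poly_time] bounds its steps on every store of
    bounded size, and [eval_wp] reconciles the two, since surplus steps leave halted configurations
    alone. The other obstacle is that the recovered rows are correlated with the first-round
    queries. They are exchanged for the true rows outcome by outcome: once queries and rows are
    given, the acceptance probability over the second round lies in [0,1], so the exchange costs at
    most the probability that some row is wrong, which a union over the batch bounds. *)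

Lemma dbind_cons (p : rat * S) m f :
  dbind (p :: m) f = [seq (p.1 * q.1, q.2) | q <- f p.2] ++ dbind m f.
Proof. by []. Qed.

Lemma dbind_ret (x : S) f : dbind (dret x) f = f x.
Proof.
rewrite /dbind /= cats0 -[RHS]map_id.
by apply: eq_map => -[w y]; rewrite mul1r.
Qed.

Lemma eq_dbind f f' m : f =1 f' -> dbind m f = dbind m f'.
Proof. by move=> ff'; elim: m => //= p m IH; rewrite !dbind_cons IH ff'. Qed.

Lemma dbind_cat m m' f : dbind (m ++ m') f = dbind m f ++ dbind m' f.
Proof. by rewrite /dbind map_cat flatten_cat. Qed.

Lemma dbind_scale (a : rat) m f :
  dbind [seq (a * q.1, q.2) | q <- m] f =
  [seq (a * q.1, q.2) | q <- dbind m f].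
Proof.
elim: m => //= p m IH; rewrite !dbind_cons IH map_cat; congr cat.
by rewrite -map_comp; apply: eq_map => q /=; rewrite mulrA.
Qed.

End Monad.

Lemma dbind_dret S (m : dist S) : dbind m (@dret S) = m.
Proof. by elim: m => //= -[w x] m IH; rewrite dbind_cons /= IH mulr1. Qed.

Lemma dbindA S T U (m : dist S) (f : S -> dist T) (g : T -> dist U) :
  dbind (dbind m f) g = dbind m (fun x => dbind (f x) g).
Proof.
elim: m => //= p m IH.
by rewrite !dbind_cons dbind_cat IH dbind_scale.
Qed.

Definition monadE := (dbindA, dbind_ret).

Lemma dmap_comp S T U (f : S -> T) (g : T -> U) m :
  dmap g (dmap f m) = dmap (fun x => g (f x)) m.
Proof. by rewrite /dmap dbindA; apply: eq_dbind => x; rewrite dbind_ret. Qed.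

Lemma eq_dmap S T (f g : S -> T) m : f =1 g -> dmap f m = dmap g m.
Proof. by move=> fg; apply: eq_dbind => x; rewrite fg. Qed.

Lemma dbind_map S T U (f : S -> T) (g : T -> dist U) m :
  dbind (dmap f m) g = dbind m (fun x => g (f x)).
Proof. by rewrite /dmap dbindA; apply: eq_dbind => x; rewrite dbind_ret. Qed.

(* Equal weights in the same order, related outcomes: as the monad laws hold on
   the nose for lists, this is enough to compare a program with its
   specification. *)
Definition drel S T (phi : S -> T -> Prop) (m : dist S) (m' : dist T) : Prop :=
  List.Forall2 (fun p q => p.1 = q.1 /\ phi p.2 q.2) m m'.

Definition dall S (P : S -> Prop) (m : dist S) : Prop :=
  List.Forall (fun p => P p.2) m.

Section Coupling.
Local Open Scope ring_scope.
Variables S T S' T' : Type.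

Lemma drel_ret (phi : S -> T -> Prop) x y :
  phi x y -> drel phi (dret x) (dret y).
Proof. by move=> xy; constructor. Qed.

Lemma drel_weaken (phi psi : S -> T -> Prop) m m' :
  (forall x y, phi x y -> psi x y) -> drel phi m m' -> drel psi m m'.
Proof.
by move=> sub; elim=> [|p q {}m {}m' [pq pqR] _ IH]; constructor; auto.
Qed.

Lemma drel_bind (phi : S -> T -> Prop) (psi : S' -> T' -> Prop) m m' f g :
  drel phi m m' -> (forall x y, phi x y -> drel psi (f x) (g y)) ->
  drel psi (dbind m f) (dbind m' g).
Proof.
move=> rel relf; elim: rel => [|p q {}m {}m' [pq pqR] _ IH]; first by constructor.
rewrite !dbind_cons; apply: List.Forall2_app => //.
elim: (relf _ _ pqR) => [|a b l l' [ab abR] _ IHl] /=; first by constructor.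
by constructor => //; rewrite pq ab.
Qed.

Lemma drel_map (h : S -> T) m m' : drel (fun x y => h x = y) m m' -> dmap h m = m'.
Proof.
elim=> [|[w x] [w' y] {}m {}m' /= [<- <-] _ IH]; first by [].
by rewrite /dmap dbind_cons /= mulr1; congr cons.
Qed.

Lemma drel_all (phi : S -> T -> Prop) (P : S -> Prop) m m' :
  drel phi m m' -> (forall x y, phi x y -> P x) -> dall P m.
Proof.
by move=> rel sub; elim: rel => [|p q {}m {}m' [_ /sub ?] _ IH]; constructor.
Qed.

(* The bounds T0 differ from outcome to outcome; a finite list has a largest
   one. *)
Lemma drel_bound (phi : S -> T -> Prop) (Q : nat -> S -> T -> Prop) m m' :
  (forall x y a b, (a <= b)%N -> Q a x y -> Q b x y) ->
  drel phi m m' -> (forall x y, phi x y -> exists a, Q a x y) ->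
  exists a, drel (Q a) m m'.
Proof.
move=> Qmono rel ex; elim: rel => [|p q {}m {}m' [pq /ex[a Qa]] _ [b Qb]].
  by exists 0%N; constructor.
exists (maxn a b); constructor; first by split=> //; apply: Qmono Qa; lia.
by apply: drel_weaken Qb => x y; apply: Qmono; lia.
Qed.

Lemma dall_impl (P Q : S -> Prop) m :
  (forall x, P x -> Q x) -> dall P m -> dall Q m.
Proof. by move=> PQ; apply: List.Forall_impl => p; apply: PQ. Qed.

Lemma dall_bind (P : S -> Prop) (Q : T -> Prop) m f :
  dall P m -> (forall x, P x -> dall Q (f x)) -> dall Q (dbind m f).
Proof.
move=> all_m all_f; elim: all_m => [|p {}m Pp _ IH]; first by constructor.
rewrite dbind_cons; apply/List.Forall_app; split=> //.
by elim: (all_f _ Pp) => [|a l Qa _ IHl] /=; constructor.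
Qed.

Lemma dall_bindE (Q : T -> Prop) (m : dist S) f :
  dall Q (dbind m f) -> dall (fun x => dall Q (f x)) m.
Proof.
elim: m => [|p m IH]; first by constructor.
rewrite dbind_cons => /List.Forall_app[all_p /IH all_m]; constructor => //.
rewrite /dall /=; elim: (f p.2) all_p => [|a l IHl] /= all_p; first by constructor.
by inversion all_p; constructor; auto.
Qed.

Lemma dall_ret (P : S -> Prop) x : dall P (dret x) <-> P x.
Proof. by split=> [all_x|]; [inversion all_x | constructor]. Qed.

Lemma dall_and (P Q : S -> Prop) m :
  dall P m -> dall Q m -> dall (fun x => P x /\ Q x) m.
Proof. exact: List.Forall_and. Qed.

Lemma eq_dbind_in (P : S -> Prop) m (f g : S -> dist T) :
  dall P m -> (forall x, P x -> f x = g x) -> dbind m f = dbind m g.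
Proof.
by move=> all_m fg; elim: all_m => [//|p {}m /fg E _ IH]; rewrite !dbind_cons E IH.
Qed.

End Coupling.

(** * Multi-stack machines *)

Definition halted (c : config) : Prop := c.1 = [::].

Lemma upd_same s x v : upd s x v x = v.
Proof. by rewrite /upd eqxx. Qed.

Lemma stepsS n c : steps n.+1 c = dbind (step c) (steps n).
Proof. by []. Qed.

Lemma steps_nil n s : steps n ([::], s) = dret ([::], s).
Proof. by elim: n => //= n IH; rewrite dbind_ret. Qed.

Lemma stepsD n m c : steps (n + m) c = dbind (steps n c) (steps m).
Proof.
elim: n c => [|n IH] c; first by rewrite dbind_ret.
by rewrite addSn /= dbindA; apply: eq_dbind.
Qed.

Lemma steps_stable n N c :
  dall halted (steps n c) -> n <= N -> steps N c = steps n c.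
Proof.
move=> halt /subnKC <-; rewrite stepsD -[RHS]dbind_dret.
by apply: (eq_dbind_in halt) => -[k s]; rewrite /halted /= => ->; rewrite steps_nil.
Qed.

Lemma step_cat c k k2 s :
  step (c :: k ++ k2, s) =
  dmap (fun c' : config => (c'.1 ++ k2, c'.2)) (step (c :: k, s)).
Proof.
by case: c => [|c1 c2|x b|x|x|x c0 cf ct|x c] /=;
  rewrite /dmap ?monadE //=; case: (s x).
Qed.

(** A branch of [k1] that halts before [T1] passes its remaining steps to [k2], which then idles
    after halting; hence both sides agree as lists. *)
Lemma steps_cat T1 T2 k1 k2 s :
  dall halted (steps T1 (k1, s)) ->
  dall (fun c => dall halted (steps T2 (k2, c.2))) (steps T1 (k1, s)) ->
  steps (T1 + T2) (k1 ++ k2, s) =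
  dbind (steps T1 (k1, s)) (fun c => steps T2 (k2, c.2)).
Proof.
elim: T1 k1 s => [|T1 IH] [|c k] s halt1 halt2.
- by rewrite dbind_ret.
- by move/dall_ret: halt1.
- rewrite steps_nil dbind_ret; apply: steps_stable; last exact: leq_addl.
  by move: halt2; rewrite steps_nil => /dall_ret.
rewrite addSn !stepsS step_cat /dmap !dbindA.
have halt1' := dall_bindE halt1; have halt2' := dall_bindE halt2.
apply: (eq_dbind_in (dall_and halt1' halt2')) => -[k' s'] [h1 h2].
by rewrite dbind_ret IH.
Qed.

(** * Specifications of randomized programs *)

(** Final configurations are matched one by one with the outcomes in [m], so [phi] can tie a store
    to the random outcome behind it. *)
Definition wp (k : seq cmd) (s : store) X (m : dist X)
    (phi : X -> store -> Prop) : Prop :=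
  exists T, drel (fun (c : config) x => halted c /\ phi x c.2) (steps T (k, s)) m.

Lemma wp_cat k1 k2 s X Y (m1 : dist X) (m2 : X -> dist Y) phi1 phi2 :
  wp k1 s m1 phi1 ->
  (forall x s', phi1 x s' -> wp k2 s' (m2 x) phi2) ->
  wp (k1 ++ k2) s (dbind m1 m2) phi2.
Proof.
case=> T1 rel1 rel2.
(* The time that [k2] needs depends on the outcome of [k1]. Since the second run is required to
   halt, [Q] is monotone in [T], and [drel_bound] yields a common time. *)
pose Q T (c : config) x := halted c /\
  drel (fun (c' : config) y => halted c' /\ phi2 y c'.2) (steps T (k2, c.2)) (m2 x).
have [T2 relQ] : exists T2, drel (Q T2) (steps T1 (k1, s)) m1.
  apply: drel_bound rel1 _ => [c x a b ab [hc rel]|c x [hc /rel2[T rel]]].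
    split=> //; rewrite (steps_stable _ ab) //.
    by apply: drel_all rel _ => c' y [].
  by exists T.
exists (T1 + T2); rewrite steps_cat.
- by apply: drel_bind relQ _ => c x [].
- by apply: drel_all relQ _ => c x [].
by apply: drel_all relQ _ => c x [_ rel]; apply: drel_all rel _ => c' y [].
Qed.

Lemma wp_weaken k s X (m : dist X) (phi psi : X -> store -> Prop) :
  (forall x s', phi x s' -> psi x s') -> wp k s m phi -> wp k s m psi.
Proof.
move=> sub [T rel]; exists T; apply: drel_weaken rel => c x [? /sub ?].
by split.
Qed.

Lemma ppt_halted (A : ppt) ins :
  dall halted (steps (ppt_time A).[input_size ins]%R (init (ppt_code A) ins)).
Proof.
have := ppt_halts A ins; elim: (steps _ _) => [|p m IH] /=; first by constructor.
by case/andP=> /nilP hp /IH; constructor.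
Qed.

Lemma wp_ppt (A : ppt) ins :
  wp [:: ppt_code A] (fun x => nth [::] ins x) (eval A ins) eq.
Proof.
exists (ppt_time A).[input_size ins]%R; rewrite /eval.
elim: (ppt_halted A ins) => [|[w x] m hx _ IH]; first by constructor.
by rewrite /dmap dbind_cons /= mulr1; constructor.
Qed.

(** The clock of [A] and the time of the specification both reach halted configurations, so each
    gives the same result as their maximum. *)
Lemma eval_wp (A : ppt) ins X (m : dist X) (h : store -> X) :
  wp [:: ppt_code A] (fun x => nth [::] ins x) m (fun x s => h s = x) ->
  dmap h (eval A ins) = m.
Proof.
case=> T rel; rewrite /eval dmap_comp; apply: drel_map.
have halt : dall halted (steps T (init (ppt_code A) ins)).
  by apply: drel_all rel _ => c y [].
have haltA := ppt_halted A ins.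
set n := _.[_]%R in haltA *.
rewrite -(steps_stable haltA (leq_maxr T n)) (steps_stable halt (leq_maxl T n)).
by apply: drel_weaken rel => c x [].
Qed.

Lemma wp_seq c1 c2 s X Y (m1 : dist X) (m2 : X -> dist Y) phi1 phi2 :
  wp [:: c1] s m1 phi1 ->
  (forall x s', phi1 x s' -> wp [:: c2] s' (m2 x) phi2) ->
  wp [:: Seq c1 c2] s (dbind m1 m2) phi2.
Proof.
move=> wp1 wp2; have [T rel] := wp_cat wp1 wp2.
by exists T.+1; rewrite stepsS [step _]/= dbind_ret.
Qed.

Definition det (c : cmd) (s s' : store) : Prop :=
  exists n, steps n ([:: c], s) = dret ([::], s').

Lemma wp_det c s s' X (x : X) :
  det c s s' -> wp [:: c] s (dret x) (fun x' s'' => x' = x /\ s'' = s').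
Proof. by case=> n E; exists n; rewrite E; apply: drel_ret. Qed.

Lemma wp_det_seq c1 c2 s s' X (m : dist X) phi :
  det c1 s s' -> wp [:: c2] s' m phi -> wp [:: Seq c1 c2] s m phi.
Proof.
move=> det1 wp2; have wp1 := wp_det tt det1; rewrite -(dbind_ret tt (fun=> m)).
by apply: (wp_seq wp1) => _ _ [_ ->].
Qed.

Lemma wp_eq k s s' X (m : dist X) phi : s =1 s' -> wp k s m phi -> wp k s' m phi.
Proof. by move=> /boolp.funext ->. Qed.

Lemma det_eq c s s1 s2 : s1 =1 s2 -> det c s s1 -> det c s s2.
Proof. by move=> /boolp.funext ->. Qed.

Lemma det_seq c1 c2 s s1 s2 : det c1 s s1 -> det c2 s1 s2 -> det (Seq c1 c2) s s2.
Proof.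
move=> [n1 E1] [n2 E2]; exists (n1 + n2).+1.
rewrite stepsS [step _]/= dbind_ret -[[:: c1; c2]]/([:: c1] ++ [:: c2]).
by rewrite steps_cat E1 ?dbind_ret //; apply/dall_ret => //=; rewrite E2; apply/dall_ret.
Qed.

(** * Running programs in disjoint windows of registers *)

Fixpoint ren (f : nat -> nat) (c : cmd) : cmd :=
  match c with
  | Skip => Skip
  | Seq c1 c2 => Seq (ren f c1) (ren f c2)
  | Push x b => Push (f x) b
  | Pop x => Pop (f x)
  | Flip x => Flip (f x)
  | Case x c0 cf ct => Case (f x) (ren f c0) (ren f cf) (ren f ct)
  | While x c => While (f x) (ren f c)
  end.

(* Window j < K consists of the registers congruent to j modulo K; each
   subprogram is given a window of its own. *)
Definition residue (K y : nat) : nat := y %% K.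

Section Windows.
Variables K j : nat.
Hypothesis ltjK : j < K.

Definition slot (x : nat) : nat := x * K + j.
Definition win (s : store) : store := fun x => s (slot x).
Definition put (s t : store) : store :=
  fun y => if residue K y == j then t (y %/ K) else s y.

Local Arguments slot : simpl never.
Local Arguments put : simpl never.

Lemma residue_slot x : residue K (slot x) = j.
Proof. by rewrite /residue /slot modnMDl modn_small. Qed.

Lemma slot_div x : slot x %/ K = x.
Proof. by rewrite /slot divnMDl ?divn_small ?addn0 //; lia. Qed.

Lemma put_slot s t x : put s t (slot x) = t x.
Proof. by rewrite /put residue_slot eqxx slot_div. Qed.

Lemma put_win s : put s (win s) = s.
Proof.
apply: boolp.funext => y; rewrite /put /win /slot /residue.
by case: eqP => // <-; rewrite -divn_eq.
Qed.

Lemma upd_put s t x v : upd (put s t) (slot x) v = put s (upd t x v).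
Proof.
apply: boolp.funext => y; rewrite /upd /put.
have [->|/eqP ne] := eqVneq y (slot x); first by rewrite residue_slot slot_div !eqxx.
case: eqP => // yj; case: eqP => // yx.
by case: ne; rewrite /slot -yx -yj /residue -divn_eq.
Qed.

Definition lift_config (s : store) (c : config) : config :=
  (map (ren slot) c.1, put s c.2).

Lemma step_ren k s t :
  step (map (ren slot) k, put s t) = dmap (lift_config s) (step (k, t)).
Proof.
case: k => [|[|c1 c2|x b|x|x|x c0 cf ct|x c] k] /=;
  rewrite /dmap ?monadE /lift_config /= ?upd_put ?put_slot //.
- by apply: eq_dbind => b; rewrite dbind_ret /= upd_put.
- by case: (t x) => [|[]].
- by case: (t x).
Qed.

(** As [slot] is injective, the renamed program moves in lockstep with the original one and touches
    no other window; step counts, hence time bounds, carry over unchanged. *)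
Lemma steps_ren n k s t :
  steps n (map (ren slot) k, put s t) = dmap (lift_config s) (steps n (k, t)).
Proof.
elim: n k t => [|n IH] k t; first by rewrite /dmap dbind_ret.
rewrite !stepsS step_ren /dmap !dbindA; apply: eq_dbind => -[k' t'].
by rewrite dbind_ret IH.
Qed.

Lemma wp_ren c s X (m : dist X) phi :
  wp [:: c] (win s) m phi ->
  wp [:: ren slot c] s m
    (fun x s' => phi x (win s') /\ forall y, residue K y != j -> s' y = s y).
Proof.
case=> T rel; exists T.
have := steps_ren T [:: c] s (win s); rewrite put_win => ->.
rewrite -[m]dbind_dret; apply: drel_bind rel _ => -[k t] x [h phix].
apply: drel_ret; split; first by rewrite /halted /= (h : k = [::]).
split=> [|y /negPf yj]; last by rewrite /= /put yj.
suff -> : win (put s t) = t by [].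
by apply: boolp.funext => y; rewrite /win put_slot.
Qed.

End Windows.

(** A [ppt] is specified on initial stores only, so the whole window has to consist of the inputs
    followed by empty registers. *)
Lemma wp_ren_ppt K j (A : ppt) ins s : j < K ->
  (forall x, s (slot K j x) = nth [::] ins x) ->
  wp [:: ren (slot K j) (ppt_code A)] s (eval A ins)
    (fun t s' => t = win K j s' /\ forall y, residue K y != j -> s' y = s y).
Proof.
move=> ltjK E; apply: wp_ren => //.
apply: (wp_eq (s := fun x => nth [::] ins x)); first by move=> x; rewrite /win E.
by apply: wp_weaken (wp_ppt A ins) => t s' ->.
Qed.

(** * Moving data between stacks *)

Fixpoint pushes (ys : seq nat) (b : bool) : cmd :=
  if ys is y :: ys' then Seq (Push y b) (pushes ys' b) else Skip.

(* As registers are stacks, pour reverses its source. *)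
Definition pour (x : nat) (ys : seq nat) : cmd :=
  While x (Case x Skip (Seq (Pop x) (pushes ys false))
                       (Seq (Pop x) (pushes ys true))).

Lemma steps_pushes ys b k s : uniq ys ->
  steps (size ys).*2.+1 (pushes ys b :: k, s) =
  dret (k, fun y => if y \in ys then b :: s y else s y).
Proof.
elim: ys s => [|y ys IH] s; first by rewrite /= dbind_ret.
case/andP=> y_ys ys_uniq; rewrite -[size _]/(size ys).+1 doubleS.
rewrite stepsS [step _]/= dbind_ret stepsS [step _]/= dbind_ret.
rewrite IH //; congr (dret (_, _)).
apply: boolp.funext => z; rewrite in_cons /upd.
by have [->|] := eqVneq z y; rewrite ?(negPf y_ys).
Qed.

(** A round takes four steps for [While], [Case], [Seq] and [Pop], then [(size ys).*2.+1] for the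
    pushes; the very last step is the failing loop test. *)
Lemma steps_pour x ys s : uniq ys -> x \notin ys ->
  steps ((size (s x)) * ((size ys).*2 + 5)).+1 ([:: pour x ys], s) =
  dret ([::], fun y => if y == x then [::] else
                       if y \in ys then catrev (s x) (s y) else s y).
Proof.
move=> ys_uniq x_ys; move: {2}(s x) (erefl (s x)) => v.
elim: v s => [|b v IH] s sx.
  rewrite sx mul0n stepsS [step _]/= sx dbind_ret; congr (dret (_, _)).
  by apply: boolp.funext => y; case: eqP => [->|]; rewrite ?sx ?if_same.
pose s' y := if y \in ys then b :: upd s x v y else upd s x v y.
have s'x : s' x = v by rewrite /s' (negPf x_ys) upd_same.
have body : steps ((size ys).*2 + 5) ([:: pour x ys], s) = dret ([:: pour x ys], s').
  have -> : (size ys).*2 + 5 = (size ys).*2.+1.+4 by lia.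
  rewrite stepsS [step _]/= sx dbind_ret -/(pour x ys) stepsS [step _]/= sx dbind_ret.
  case: b @s' {s'x} sx => s' sx; rewrite stepsS [step _]/= dbind_ret;
    by rewrite stepsS [step _]/= dbind_ret sx [behead _]/= steps_pushes.
have -> : (size (s x) * ((size ys).*2 + 5)).+1 =
    (size ys).*2 + 5 + (size (s' x) * ((size ys).*2 + 5)).+1.
  by rewrite sx s'x /=; lia.
rewrite stepsD body dbind_ret IH //; congr (dret (_, _)).
apply: boolp.funext => y; rewrite s'x sx /s' /upd.
by case: eqP => // _; case: ifP => // ->.
Qed.

(** Two reversals cancel, so the order of the bits is kept. *)
Definition transfer (x t y : nat) : cmd := Seq (pour x [:: t]) (pour t [:: y]).

(** The second pour restores the source, but the copies in [ys] stay reversed, which is harmless for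
    unary numbers. *)
Definition copy (x t : nat) (ys : seq nat) : cmd :=
  Seq (pour x (t :: ys)) (pour t [:: x]).

Lemma det_pour x ys s : uniq ys -> x \notin ys ->
  det (pour x ys) s (fun y => if y == x then [::] else
                              if y \in ys then catrev (s x) (s y) else s y).
Proof. by move=> ys_uniq x_ys; eexists; apply: steps_pour. Qed.

Lemma det_transfer x t y s : x != t -> y != t -> x != y -> s t = [::] ->
  s y = [::] ->
  det (transfer x t y) s
    (fun z => if z == y then s x else if z == x then [::] else s z).
Proof.
move=> xt yt xy st sy; have tx := xt; have ty := yt; rewrite eq_sym in tx; rewrite eq_sym in ty.
apply: det_seq (det_pour _ _ _) _; rewrite ?inE //.
apply: det_eq (det_pour _ _ _); rewrite ?inE // => z; rewrite !inE !eqxx (negPf tx).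
have [->|zt] := eqVneq z t; first by rewrite (negPf tx) (negPf ty) st.
have [->|zy] := eqVneq z y; last by [].
by rewrite st sy if_same; apply: revK.
Qed.

Lemma rev_unary n : catrev (unary n) [::] = unary n.
Proof. exact: rev_nseq. Qed.

Lemma det_copy x t ys s n : x != t -> uniq ys -> x \notin ys -> t \notin ys ->
  s x = unary n -> s t = [::] -> (forall y, y \in ys -> s y = [::]) ->
  det (copy x t ys) s (fun z => if z \in ys then unary n else s z).
Proof.
move=> xt uys xys tys sx st sys; have tx := xt; rewrite eq_sym in tx.
have u : uniq (t :: ys) by rewrite /= tys.
have x_tys : x \notin t :: ys by rewrite inE negb_or xt.
apply: det_seq (det_pour s u x_tys) _.
apply: det_eq (det_pour _ _ _); rewrite ?inE // => z; rewrite !inE !eqxx (negPf tx) sx st.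
rewrite rev_unary /=.
have [->|zt] := eqVneq z t; first by rewrite (negPf tys) st.
have [->|zx] := eqVneq z x; first by rewrite rev_unary (negPf xys) sx.
by rewrite orFb; case: ifP => // zys; rewrite (sys _ zys) rev_unary.
Qed.

Lemma det_nseq n x s : det (pushes (nseq n x) true) s (upd s x (unary n ++ s x)).
Proof.
elim: n s => [|n IH] s.
  by exists 1; rewrite /= dbind_ret; congr (dret (_, _)); apply: boolp.funext => y;
    rewrite /upd; case: eqP => // ->.
apply: (@det_seq _ _ _ (upd s x (true :: s x))).
  by exists 1; rewrite /= dbind_ret.
apply: det_eq (IH _) => y; rewrite /upd eqxx; case: eqP => // _.
by elim: (n) => //= m [->].
Qed.

(** * Polynomial running time *)

(** Finite support lets a store be read back as an input list of bounded size, see [fits_nth]. *)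
Definition fits (s : store) (N : nat) : Prop :=
  (exists M, forall x, M <= x -> s x = [::]) /\
  forall M, \sum_(x < M) size (s x) <= N.

(** The bound covers every store of size at most [N] and not only initial ones, which makes the
    notion closed under sequencing and renaming. *)
Definition poly_time (c : cmd) : Prop :=
  exists p : {poly nat}, forall s N, fits s N ->
    dall halted (steps p.[N]%R ([:: c], s)).

Lemma fits_weaken s N N' : N <= N' -> fits s N -> fits s N'.
Proof. by move=> le_NN' [fin sum]; split=> // M; apply: leq_trans (sum M) _. Qed.

Lemma fits_upd s N x v : size v <= (size (s x)).+1 -> fits s N -> fits (upd s x v) N.+1.
Proof.
move=> sz [[M0 fin] sum]; split=> [|M].
  by exists (maxn M0 x.+1) => y ley; rewrite /upd; case: eqP => [|_]; [lia | apply: fin; lia].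
apply: (@leq_trans (\sum_(y < M) (size (s y) + (nat_of_ord y == x)))).
  by apply: leq_sum => y _; rewrite /upd; have [->|] := eqVneq (val y) x; rewrite ?addn1 ?addn0.
rewrite big_split /= -addn1 leq_add ?sum //.
have [ltxM|lexM] := ltnP x M.
  rewrite (bigD1 (Ordinal ltxM)) //= eqxx big1 // => y /negPf ne.
  by rewrite (_ : (_ == x) = (y == Ordinal ltxM)) ?ne.
by rewrite big1 // => y _; have := ltn_ord y; have [->|//] := eqVneq (val y) x; lia.
Qed.

Lemma fits_step c N : fits c.2 N -> dall (fun c' => fits c'.2 N.+1) (step c).
Proof.
case: c => -[|[|c1 c2|x b|x|x|x c0 cf ct|x c] k] s /= fs;
  try by apply/dall_ret => /=; apply: fits_weaken fs.
- by apply/dall_ret; apply: fits_upd.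
- by apply/dall_ret; apply: fits_upd => //; rewrite size_behead; lia.
- apply: (@dall_bind _ _ (fun=> True)); first by repeat constructor.
  by move=> b _; apply/dall_ret; apply: fits_upd.
Qed.

Lemma fits_steps n c N : fits c.2 N -> dall (fun c' => fits c'.2 (N + n)) (steps n c).
Proof.
elim: n c N => [|n IH] c N fs; first by rewrite addn0; apply/dall_ret.
rewrite stepsS addnS -addSn.
by apply: dall_bind (fits_step fs) _ => c'; apply: IH.
Qed.

Lemma fits_win K j s N : j < K -> fits s N -> fits (win K j s) N.
Proof.
move=> ltjK [[M0 fin] sum]; split=> [|M].
  by exists M0 => x lex; apply: fin; rewrite /slot; nia.
(* The first [M] registers of the window lie among the first [M * K] registers of the store. *)
apply: leq_trans (sum (M * K)).
elim: M => [|M IH]; first by rewrite big_ord0.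
have -> : M.+1 * K = M * K + K by lia.
rewrite big_ord_recr big_split_ord leq_add //=.
by rewrite (bigD1 (Ordinal ltjK)) //= leq_addr.
Qed.

Lemma fits_nth s N : fits s N ->
  exists ins, (forall x, nth [::] ins x = s x) /\ input_size ins <= N.
Proof.
case=> -[M fin] sum; exists (mkseq s M); split=> [x|].
  have [ltxM|leMx] := ltnP x M; first by rewrite nth_mkseq.
  by rewrite nth_default ?size_mkseq // fin.
have -> : mkseq s M = [seq s i | i <- index_iota 0 M] by rewrite /index_iota subn0.
by rewrite /input_size -map_comp sumnE big_map big_mkord; apply: sum.
Qed.

Lemma nth_fits ins : fits (fun x => nth [::] ins x) (input_size ins).
Proof.
split=> [|M]; first by exists (size ins) => x; apply: nth_default.
elim: ins M => [|v ins IH] [|M]; rewrite ?big_ord0 //.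
  by rewrite big1 // => i _; rewrite nth_nil.
by rewrite big_ord_recl leq_add.
Qed.

Lemma horner_nat_mono (p : {poly nat}) m n : m <= n -> (p.[m] <= p.[n])%N%R.
Proof.
move=> le_mn; rewrite !horner_coef; apply: leq_sum => i _.
by rewrite leq_mul // !natrXE; case: (val i) => // k; rewrite leq_exp2r.
Qed.

Lemma poly_time_bound c (T : nat -> nat) (p : {poly nat}) :
  (forall N, T N <= p.[N]%R) ->
  (forall s N, fits s N -> dall halted (steps (T N) ([:: c], s))) -> poly_time c.
Proof.
move=> le_Tp halt; exists p => s N fs.
by rewrite (steps_stable (halt s N fs)); [apply: halt | apply: le_Tp].
Qed.

(** A step adds at most one bit, so the second program starts on a store of size at most [N +
    p1.[N]], where its clock is read; the extra step unfolds [Seq]. *)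
Lemma poly_time_seq c1 c2 : poly_time c1 -> poly_time c2 -> poly_time (Seq c1 c2).
Proof.
move=> [p1 h1] [p2 h2].
apply: (@poly_time_bound _ (fun N => (p1.[N]%R + p2.[N + p1.[N]%R]%R).+1)
  (p1 + (p2 \Po ('X + p1)) + 1%:P)%R) => [N|s N fs].
  by rewrite !hornerD horner_comp hornerD hornerX hornerC -addn1.
rewrite stepsS [step _]/= dbind_ret -[[:: c1; c2]]/([:: c1] ++ [:: c2]).
have halt1 := h1 _ _ fs; have fits1 := @fits_steps p1.[N]%R ([:: c1], s) N fs.
have halt2 : dall (fun c : config =>
    dall halted (steps p2.[N + p1.[N]%R]%R ([:: c2], c.2))) (steps p1.[N]%R ([:: c1], s)).
  by apply: dall_impl fits1 => c /h2.
by rewrite steps_cat //; apply: dall_bind halt2 _.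
Qed.

Lemma poly_time_ren K j c : j < K -> poly_time c -> poly_time (ren (slot K j) c).
Proof.
move=> ltjK [p h]; exists p => s N fs.
have := steps_ren ltjK p.[N]%R [:: c] s (win K j s); rewrite put_win => // ->.
apply: dall_bind (h _ _ (fits_win ltjK fs)) _ => -[k t] hk; apply/dall_ret.
by rewrite /halted /= (hk : k = [::]).
Qed.

(** The clock of a [ppt] is set for the exact input size; its natural coefficients make it monotone,
    so it may be read at any larger [N]. *)
Lemma poly_time_ppt (A : ppt) : poly_time (ppt_code A).
Proof.
exists (ppt_time A) => s N /fits_nth[ins [Es le_insN]].
have <- : (fun x => nth [::] ins x) = s by apply: boolp.funext.
rewrite (steps_stable (ppt_halted A ins)); first exact: ppt_halted.
exact: horner_nat_mono.
Qed.

Lemma poly_time_pour x ys : uniq ys -> x \notin ys -> poly_time (pour x ys).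
Proof.
move=> uys xys; pose a := ((size ys).*2 + 5).
apply: (@poly_time_bound _ (fun N => (N * a).+1) ('X * a%:P + 1%:P)%R) => [N|s N [_ sum]].
  by rewrite hornerD hornerM hornerX !hornerC -addn1.
have le : (size (s x) * a).+1 <= (N * a).+1.
  rewrite ltnS leq_mul2r; apply/orP; right; apply: leq_trans (sum x.+1).
  by rewrite big_ord_recr leq_addl.
have halt : dall halted (steps (size (s x) * a).+1 ([:: pour x ys], s)).
  by rewrite steps_pour //; apply/dall_ret.
by rewrite (steps_stable halt).
Qed.

Lemma poly_time_pushes ys b : poly_time (pushes ys b).
Proof.
elim: ys => [|y ys IH].
  by exists (1%:P)%R => s N _; rewrite hornerC /= dbind_ret; apply/dall_ret.
apply: poly_time_seq IH; exists (1%:P)%R => s N _.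
by rewrite hornerC /= dbind_ret; apply/dall_ret.
Qed.

Lemma poly_time_skip : poly_time Skip.
Proof. by exists (1%:P)%R => s N _; rewrite hornerC /= dbind_ret; apply/dall_ret. Qed.

Lemma poly_time_transfer x t y : x != t -> y != t -> poly_time (transfer x t y).
Proof.
by move=> xt yt; apply: poly_time_seq; apply: poly_time_pour; rewrite ?inE // eq_sym.
Qed.

Lemma poly_time_copy x t ys : x != t -> uniq ys -> x \notin ys -> t \notin ys ->
  poly_time (copy x t ys).
Proof.
move=> xt uys xys tys; apply: poly_time_seq; apply: poly_time_pour;
  rewrite ?inE ?negb_or ?xt //= ?tys // eq_sym //.
Qed.

Lemma ppt_of_poly_time c : poly_time c -> exists A : ppt, ppt_code A = c.
Proof.
case=> p h; suff halts ins : all (fun q => nilp q.2.1) (steps p.[input_size ins]%R (init c ins)).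
  by exists (Ppt halts).
elim: (h _ _ (nth_fits ins)) => //= -[w [k s]] m hk _ ->.
by rewrite (hk : k = [::]).
Qed.

(** * Machines that sample batches of queries *)

(** One query made from a fresh private state. The record type of the scheme is forgotten, so that
    queries of both schemes can stand in one list. *)
Record sampler : Type := Sampler {
  s_prep : ppt;
  s_query : ppt;
  s_index : nat
}.

Definition message (sg : sampler) (lam : nat) : dist bits :=
  let* u := eval (s_prep sg) [:: unary lam] in
  let* v := eval (s_query sg) [:: unary lam; u 0; unary (s_index sg)] in
  dret (v 0).

Fixpoint messages (sgs : seq sampler) (lam : nat) : dist (seq bits) :=
  if sgs is sg :: sgs' then
    let* q := message sg lam in dmap (cons q) (messages sgs' lam)
  else dret [::].

Lemma wp_map k s X Y (h : X -> Y) (m : dist X) phi (psi : Y -> store -> Prop) :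
  (forall x s', phi x s' -> psi (h x) s') ->
  wp k s m phi -> wp k s (dmap h m) psi.
Proof.
move=> sub [T rel]; exists T; rewrite -[steps _ _]dbind_dret.
by apply: drel_bind rel _ => c x [hc /sub ?]; apply: drel_ret.
Qed.

Section Programs.
(* Register L holds the security parameter in unary, t is scratch space. *)
Variables K L t : nat.

(** Register [a] is register 0 of window [a], and likewise for [a.+1]. The security parameter enters
    both windows there, the private state goes from the first to register 1 of the second, and the
    index is hard-wired into its register 2. *)
Definition sample (a : nat) (sg : sampler) (d : nat) : cmd :=
  Seq (copy L t [:: a; a.+1])
  (Seq (ren (slot K a) (ppt_code (s_prep sg)))
  (Seq (transfer a t (slot K a.+1 1))
  (Seq (pushes (nseq (s_index sg) (slot K a.+1 2)) true)
  (Seq (ren (slot K a.+1) (ppt_code (s_query sg)))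
       (transfer a.+1 t d))))).

Fixpoint collect (a : nat) (l : seq (sampler * nat)) : cmd :=
  if l is (sg, d) :: l' then Seq (sample a sg d) (collect a.+2 l') else Skip.

Lemma neq_mod y z : residue K y <> residue K z -> (y == z) = false.
Proof. by move=> ne; apply/eqP => E; apply: ne; rewrite E. Qed.

Hypothesis neLt : L != t.

Lemma wp_sample a sg d s lam :
  a.+1 < K -> residue K L < a -> residue K t < a -> residue K d < a -> d != t ->
  s L = unary lam -> s t = [::] -> (d != L) -> s d = [::] ->
  (forall y, a <= residue K y -> s y = [::]) ->
  wp [:: sample a sg d] s (message sg lam)
    (fun q s' => s' d = q /\
       forall y, y != d -> (residue K y < a) || (a.+1 < residue K y) -> s' y = s y).
Proof.
move=> ltaK La ta da ndt sL st ndL sd sempty.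
have aK : residue K a = a by rewrite /residue modn_small //; lia.
have a1K : residue K a.+1 = a.+1 by rewrite /residue modn_small.
have slK j x : j < K -> residue K (slot K j x) = j by move=> ltjK; apply: residue_slot.
have La0 : L != a by rewrite neq_mod //; lia.
have La1 : L != a.+1 by rewrite neq_mod //; lia.
have ta0 : t != a by rewrite neq_mod //; lia.
have ta1 : t != a.+1 by rewrite neq_mod //; lia.
have det1 : det (copy L t [:: a; a.+1]) s
    (fun z => if z \in [:: a; a.+1] then unary lam else s z).
  apply: det_copy; rewrite ?inE ?negb_or ?La0 ?La1 ?ta0 ?ta1 //=.
    by rewrite inE andbT; apply/eqP; lia.
  by move=> y; rewrite !inE => /orP[] /eqP ->; apply: sempty; lia.
apply: wp_det_seq det1 _; set s1 := (X in wp _ X).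
have s1E y : residue K y <> a -> residue K y <> a.+1 -> s1 y = s y.
  by move=> ya yb; rewrite /s1 !inE !neq_mod ?aK ?a1K.
(* Beyond register 0 both windows are still empty, as a [ppt] started in them expects. *)
have s1slot j x : (j == a) || (j == a.+1) -> s1 (slot K j x.+1) = [::].
  move=> ja; have ltjK : j < K by lia.
  have -> : s1 (slot K j x.+1) = s (slot K j x.+1).
    rewrite /s1 !inE; case: ifP => // /orP[]/eqP; rewrite /slot mulSn; lia.
  by apply: sempty; rewrite slK //; lia.
have run1 : wp [:: ren (slot K a) (ppt_code (s_prep sg))] s1
      (eval (s_prep sg) [:: unary lam])
      (fun u s' => u = win K a s' /\ forall y, residue K y != a -> s' y = s1 y).
  apply: wp_ren_ppt => [|x]; first by lia.
  case: x => [|x]; first by rewrite /s1 /slot !inE eqxx.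
  by rewrite s1slot ?eqxx //= nth_nil.
apply: (wp_seq run1) => u s2 [-> s2E].
have det2 : det (transfer a t (slot K a.+1 1)) s2 (fun z =>
    if z == slot K a.+1 1 then s2 a else if z == a then [::] else s2 z).
  apply: det_transfer; rewrite 1?eq_sym ?ta0 ?neq_mod ?slK ?aK //; try lia.
  - by rewrite s2E ?s1E //; try lia.
  - by rewrite s2E ?slK ?s1slot ?eqxx ?orbT //; lia.
apply: wp_det_seq det2 _; set s3 := (X in wp _ X).
apply: wp_det_seq (det_nseq _ _ _) _; set s4 := (X in wp _ X).
have s4E y : residue K y <> a -> residue K y <> a.+1 -> s4 y = s y.
  move=> ya yb; rewrite /s4 /upd neq_mod ?slK // /s3 !neq_mod ?slK ?aK //.
  by rewrite s2E ?s1E //; apply/eqP.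
have s3slot x : x != 1 -> s3 (slot K a.+1 x) = s1 (slot K a.+1 x).
  move=> x1; rewrite /s3; have -> : (slot K a.+1 x == slot K a.+1 1) = false.
    by apply/eqP; rewrite /slot; have := x1; nia.
  by rewrite neq_mod ?slK ?aK //; [rewrite s2E // slK //|]; lia.
have run2 : wp [:: ren (slot K a.+1) (ppt_code (s_query sg))] s4
      (eval (s_query sg) [:: unary lam; win K a s2 0; unary (s_index sg)])
      (fun v s' => v = win K a.+1 s' /\ forall y, residue K y != a.+1 -> s' y = s4 y).
  apply: wp_ren_ppt => // x.
  rewrite /s4 /upd s3slot // s1slot ?eqxx ?orbT // cats0.
  case: x => [|[|[|x]]] /=.
  - case: ifP => [/eqP|_]; first by rewrite /slot; nia.
    by rewrite s3slot // /s1 /slot !inE eqxx orbT.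
  - case: ifP => [/eqP|_]; first by rewrite /slot; nia.
    by rewrite /s3 eqxx.
  - by rewrite eqxx.
  - case: ifP => [/eqP|_]; first by rewrite /slot; nia.
    by rewrite s3slot // s1slot ?eqxx ?orbT // nth_nil.
apply: (wp_seq run2) => v s5 [-> s5E].
have det5 : det (transfer a.+1 t d) s5 (fun z =>
    if z == d then s5 a.+1 else if z == a.+1 then [::] else s5 z).
  apply: det_transfer; rewrite 1?eq_sym ?ta1 //.
  - by rewrite eq_sym.
  - by rewrite neq_mod //; lia.
  - by rewrite s5E ?s4E //; lia.
  - by rewrite s5E ?s4E //; lia.
apply: wp_weaken (wp_det _ det5) => _ s6 [-> ->]; rewrite eqxx; split=> // y ynd yout.
by rewrite (negPf ynd) neq_mod ?s5E ?s4E //; lia.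
Qed.

(** Each sample takes two new windows and may leave garbage in them; emptiness is demanded only from
    window [a] on, so the induction goes through with [a.+2]. *)
Lemma wp_collect (l : seq (sampler * nat)) a (s : store) lam :
  a + (size l).*2 <= K -> residue K L < a -> residue K t < a ->
  uniq (map snd l) ->
  (forall d, d \in map snd l ->
    [/\ residue K d < a, d != t, d != L & s d = [::]]) ->
  s L = unary lam -> s t = [::] -> (forall y, a <= residue K y -> s y = [::]) ->
  wp [:: collect a l] s (messages (map fst l) lam)
    (fun qs s' => map s' (map snd l) = qs /\
       forall y, residue K y < a -> y \notin map snd l -> s' y = s y).
Proof.
elim: l a s => [|[sg d] l IH] a s /=.
  move=> _ _ _ _ _ _ _ _; exists 1; rewrite /= dbind_ret; apply: drel_ret.
  by split=> //; split.
move=> leK La ta /andP[d_l ul] dests sL st sempty.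
have [da dt dL sd] := dests _ (mem_head _ _).
apply: (wp_seq (wp_sample _ _ _ _ _ _ sL st _ sd sempty)) => //; try lia.
move=> q s1 [s1d s1E].
have IH1 : wp [:: collect a.+2 l] s1 (messages (map fst l) lam)
    (fun qs s' => map s' (map snd l) = qs /\
       forall y, residue K y < a.+2 -> y \notin map snd l -> s' y = s1 y).
  apply: IH => //; try lia.
  - move=> e el; have [|ea et eL se] := dests e; first by rewrite inE el orbT.
    split=> //; first by lia.
    by rewrite s1E ?ea //; apply: contraNneq d_l => <-.
  - by rewrite s1E // 1?eq_sym // La.
  - by rewrite s1E // 1?eq_sym // ta.
  - move=> y ya; rewrite s1E ?sempty //; try lia.
    by rewrite neq_mod //; lia.
apply: wp_map IH1.
- move=> qs s' [Eqs s'E]; split.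
    by rewrite -Eqs s'E ?s1d //; lia.
  move=> y ya; rewrite inE negb_or => /andP[yd yl].
  by rewrite s'E ?s1E ?ya //; lia.
Qed.

Lemma poly_time_sample a sg d :
  a.+1 < K -> residue K L < a -> residue K t < a -> d != t -> poly_time (sample a sg d).
Proof.
move=> ltaK La ta ndt.
have aK : residue K a = a by rewrite /residue modn_small //; lia.
have a1K : residue K a.+1 = a.+1 by rewrite /residue modn_small.
have La0 : L != a by rewrite neq_mod //; lia.
have La1 : L != a.+1 by rewrite neq_mod //; lia.
have ta0 : a != t by rewrite neq_mod //; lia.
have ta1 : a.+1 != t by rewrite neq_mod //; lia.
apply: poly_time_seq.
  apply: poly_time_copy; rewrite ?inE ?negb_or ?La0 ?La1 //=.
    by rewrite inE andbT; apply/eqP; lia.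
  by rewrite !(eq_sym t) ta0 ta1.
apply: poly_time_seq; first by apply: poly_time_ren; [lia | apply: poly_time_ppt].
apply: poly_time_seq.
  by apply: poly_time_transfer; rewrite // neq_mod ?residue_slot //; lia.
apply: poly_time_seq; first exact: poly_time_pushes.
apply: poly_time_seq; first by apply: poly_time_ren; [lia | apply: poly_time_ppt].
exact: poly_time_transfer.
Qed.

Lemma poly_time_collect a (l : seq (sampler * nat)) :
  a + (size l).*2 <= K -> residue K L < a -> residue K t < a -> t \notin map snd l ->
  poly_time (collect a l).
Proof.
elim: l a => [|[sg d] l IH] a /=; first by move=> *; apply: poly_time_skip.
rewrite inE negb_or => leK La ta /andP[td tl].
apply: poly_time_seq; first by apply: poly_time_sample; rewrite 1?eq_sym //; lia.
by apply: IH => //; lia.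
Qed.

End Programs.

Lemma unzip1_zip_map T (sgs : seq T) (f : nat -> nat) :
  map fst (zip sgs (map f (iota 0 (size sgs)))) = sgs.
Proof. by rewrite -/unzip1 unzip1_zip // size_map size_iota. Qed.

Lemma unzip2_zip_map T (sgs : seq T) (f : nat -> nat) :
  map snd (zip sgs (map f (iota 0 (size sgs)))) = map f (iota 0 (size sgs)).
Proof. by rewrite -/unzip2 unzip2_zip // size_map size_iota. Qed.

Lemma residue_small K y : y < K -> residue K y = y.
Proof. exact: modn_small. Qed.

Lemma messages_samplable (sgs : seq sampler) : exists S : ppt, forall lam,
  dmap (fun s : store => mkseq s (size sgs)) (eval S [:: unary lam]) =
  messages sgs lam.
Proof.
(* Registers below [B] receive the messages. The input sits in register 0, a destination when
   [B > 0], and is moved to [L] beforehand; [B.+1] differs from 0 even when [B = 0]. The sampling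
   windows start at [t.+1]. *)
pose B := size sgs; pose L := B.+1; pose t := B.+2; pose K := t.+1 + B.*2.
pose l := zip sgs (map id (iota 0 B)).
have szl : size l = B by rewrite size_zip size_map size_iota minnn.
have El1 : map fst l = sgs by apply: unzip1_zip_map.
have El2 : map snd l = iota 0 B by rewrite unzip2_zip_map map_id.
have LK : residue K L = L by apply: residue_small; lia.
have tK : residue K t = t by apply: residue_small; lia.
have neLt : L != t by apply/eqP; lia.
have pt : poly_time (Seq (pour 0 [:: L]) (collect K L t t.+1 l)).
  apply: poly_time_seq; first exact: poly_time_pour.
  apply: poly_time_collect; rewrite ?szl ?LK ?tK ?El2 ?mem_iota //; lia.
have [S codeS] := ppt_of_poly_time pt; exists S => lam; apply: eval_wp.
rewrite codeS; apply: wp_det_seq (det_pour _ _ _) _ => //; set s1 := (X in wp _ X).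
have s1E y : y != 0 -> y != L -> s1 y = [::].
  move=> /negPf y0 /negPf yL; rewrite /s1 !inE y0 yL.
  by case: y {yL} y0 => // y _; rewrite /= nth_nil.
rewrite -El1; apply: wp_weaken (wp_collect _ _ _ _ _ _ _ _ _) => //.
- by move=> qs s' [<- _]; rewrite El2 El1.
- by rewrite szl; lia.
- by rewrite LK; lia.
- by rewrite tK.
- by rewrite El2 iota_uniq.
- move=> d; rewrite El2 mem_iota => /andP[_ dB]; split; try lia.
    by rewrite residue_small; lia.
  have [->|d0] := eqVneq d 0; first by rewrite /s1 eqxx.
  by apply: s1E => //; lia.
- by rewrite /s1 !inE eqxx /= nth_nil rev_unary.
- by rewrite s1E //; lia.
move=> y ty; apply: s1E; apply/eqP => E; move: ty; rewrite E ?LK ?residue_small; lia.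
Qed.

Lemma nth_insert (T : Type) (x0 q : T) (qs : seq T) h y : h <= size qs ->
  nth x0 (take h qs ++ q :: drop h qs) y =
  if y == h then q else nth x0 qs (unbump h y).
Proof.
move=> leh; rewrite nth_cat size_takel // /unbump.
have [lt_yh|lt_hy|->] := ltngtP y h; last by rewrite subnn.
  by rewrite nth_take // subn0.
by case: y lt_hy => // y lt_hy; rewrite subSn //= nth_drop subnKC // subn1.
Qed.

(** The hybrid reduction: the challenge [q] is placed at position [h] among messages that the
    machine samples itself, and [A] runs on the result. [A] lives in window 0, which shares register
    0 with the store, so the security parameter is already in place and the verdict appears where it
    is read. *)
Lemma embed_challenge (A : ppt) (sgs : seq sampler) (h : nat) : h <= size sgs ->
  exists A' : ppt, forall lam q,
    dmap (fun s : store => s 0) (eval A' [:: unary lam; q]) =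
    let* qs := messages sgs lam in
    dmap (fun s : store => s 0) (eval A (unary lam :: take h qs ++ q :: drop h qs)).
Proof.
(* Residue 0 is the window of [A], registers 1 and 2 are the incoming challenge and the scratch
   space, and each of the [n] samplers takes two windows. *)
move=> leh; pose n := size sgs; pose K := 3 + n.*2.
(* [bump h] leaves position [h] to the challenge; the successor skips the security parameter in
   register 0. *)
pose f j := slot K 0 (bump h j).+1.
pose l := zip sgs (map f (iota 0 n)).
have szl : size l = n by rewrite size_zip size_map size_iota minnn.
have El1 : map fst l = sgs by apply: unzip1_zip_map.
have El2 : map snd l = map f (iota 0 n) by rewrite unzip2_zip_map.
have slot0 x : residue K (slot K 0 x) = 0 by apply: residue_slot.
have slot_inj x y : slot K 0 x = slot K 0 y -> x = y by rewrite /slot /K; nia.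
have slot_ge x : 2 < slot K 0 x.+1 by rewrite /slot /K; nia.
have f_ge j : 2 < f j by apply: slot_ge.
have K0 : residue K 0 = 0 by apply: residue_small.
have K2 : residue K 2 = 2 by apply: residue_small; lia.
have ne2 x : slot K 0 x.+1 != 2 by have := slot_ge x; lia.
have pt : poly_time (Seq (transfer 1 2 (slot K 0 h.+1))
    (Seq (collect K 0 2 3 l) (ren (slot K 0) (ppt_code A)))).
  apply: poly_time_seq; first exact: poly_time_transfer.
  apply: poly_time_seq; last by apply: poly_time_ren; [|apply: poly_time_ppt].
  apply: poly_time_collect; rewrite ?szl ?K0 ?K2 ?El2 //.
  by apply/mapP => -[j _ E]; have := ne2 (bump h j); rewrite -/(f j) -E.
have [A' codeA'] := ppt_of_poly_time pt; exists A' => lam q; apply: eval_wp.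
have move_input : det (transfer 1 2 (slot K 0 h.+1)) (fun x => nth [::] [:: unary lam; q] x)
    (fun z => if z == slot K 0 h.+1 then q else
              if z == 1 then [::] else nth [::] [:: unary lam; q] z).
  exact: det_transfer.
rewrite codeA'; apply: wp_det_seq move_input _.
set s1 := (X in wp _ X).
have s1E y : y != slot K 0 h.+1 -> y != 0 -> s1 y = [::].
  by case: y => [|[|y]] /negPf ne // _; rewrite /s1 ne //= nth_nil.
have s10 : s1 0 = unary lam by rewrite /s1; case: eqP => //; have := slot_ge h; lia.
have fh j : f j != slot K 0 h.+1.
  by apply/eqP => /slot_inj [] E; have := neq_bump h j; rewrite E eqxx.
rewrite -El1.
have run1 : wp [:: collect K 0 2 3 l] s1 (messages (map fst l) lam)
    (fun qs s' => map s' (map snd l) = qs /\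
       forall y, residue K y < 3 -> y \notin map snd l -> s' y = s1 y).
  apply: wp_collect; rewrite ?szl ?K0 ?K2 //.
  - by rewrite El2 map_inj_uniq ?iota_uniq // => j j' /slot_inj [] /(can_inj (@bumpK h)).
  - move=> d; rewrite El2 => /mapP[j _ ->]; have fj := f_ge j.
    have fj2 : f j != 2 by apply/eqP => E; rewrite E in fj.
    have fj0 : f j != 0 by apply/eqP => E; rewrite E in fj.
    by split; rewrite ?slot0 // s1E.
  - move=> y ty; apply: s1E; apply/eqP => E; move: ty; rewrite E ?slot0 ?K0 //.
apply: (wp_seq run1).
move=> qs s2 [Eqs s2E].
have szqs : size qs = n by rewrite -Eqs El2 !size_map size_iota.
have run2 : wp [:: ren (slot K 0) (ppt_code A)] s2
    (eval A (unary lam :: take h qs ++ q :: drop h qs))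
    (fun v s' => v = win K 0 s' /\ forall y, residue K y != 0 -> s' y = s2 y).
  apply: wp_ren_ppt => // -[|x] /=.
    rewrite s2E ?K0 //; rewrite El2; apply/mapP => -[j _ E].
    by have := f_ge j; rewrite -E.
  rewrite nth_insert ?szqs //.
  have [->|xh] := eqVneq x h.
    rewrite s2E ?slot0 //; first by rewrite /s1 eqxx.
    by rewrite El2; apply/mapP => -[j _ E]; have := fh j; rewrite E eqxx.
  have Ex : slot K 0 x.+1 = f (unbump h x) by rewrite /f unbumpK // inE.
  rewrite Ex; have [ltn|gen] := ltnP (unbump h x) n.
    by rewrite -Eqs El2 -map_comp (nth_map 0) ?size_iota // nth_iota.
  have fn : f (unbump h x) \notin map snd l.
    rewrite El2; apply/mapP => -[j]; rewrite mem_iota => /andP[_ ltj].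
    by move=> /slot_inj [] /(can_inj (@bumpK h)) E; move: gen; rewrite E leqNgt ltj.
  rewrite nth_default ?szqs // s2E ?slot0 //.
  have fj := f_ge (unbump h x).
  by rewrite s1E ?fh //; apply/eqP => E; rewrite E in fj.
by apply: wp_map run2 => v s' [-> _].
Qed.

(** * Expectations *)

Local Open Scope ring_scope.

(** Reordering independent draws changes the list but no expectation; from here on distributions are
    compared through [ex]. *)
Definition ex T (m : dist T) (f : T -> rat) : rat := \sum_(p <- m) p.1 * f p.2.

Definition nonneg T (m : dist T) : bool := all (fun p => 0 <= p.1) m.

Definition prob T (m : dist T) : Prop := nonneg m /\ ex m (fun=> 1) = 1.

Lemma ex_ret T (x : T) f : ex (dret x) f = f x.
Proof. by rewrite /ex big_seq1 mul1r. Qed.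

Section Expectation.
Variables S T : Type.
Implicit Types (m : dist S) (f g : S -> rat).

Lemma ex_bind m (k : S -> dist T) (f : T -> rat) :
  ex (dbind m k) f = ex m (fun x => ex (k x) f).
Proof.
elim: m => [|p m IH]; first by rewrite /ex !big_nil.
rewrite dbind_cons /ex big_cat big_map /= -/(ex _ _) IH big_cons mulr_sumr.
by congr (_ + _); apply: eq_bigr => q _; rewrite mulrA.
Qed.

Lemma ex_map m (h : S -> T) (f : T -> rat) : ex (dmap h m) f = ex m (fun x => f (h x)).
Proof.
by rewrite ex_bind; apply: eq_bigr => p _; rewrite ex_ret.
Qed.

Lemma eq_ex m f g : f =1 g -> ex m f = ex m g.
Proof. by move=> fg; apply: eq_bigr => p _; rewrite fg. Qed.

Lemma exB m f g : ex m (fun x => f x - g x) = ex m f - ex m g.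
Proof. by rewrite /ex -sumrB; apply: eq_bigr => p _; rewrite mulrBr. Qed.

Lemma ex_sum (I : Type) (r : seq I) m (F : I -> S -> rat) :
  ex m (fun x => \sum_(i <- r) F i x) = \sum_(i <- r) ex m (F i).
Proof. by rewrite /ex exchange_big; apply: eq_bigr => p _; rewrite mulr_sumr. Qed.

Lemma ex_swap m (m' : dist T) (F : S -> T -> rat) :
  ex m (fun x => ex m' (F x)) = ex m' (fun y => ex m (fun x => F x y)).
Proof.
rewrite /ex; under eq_bigr => p _ do rewrite mulr_sumr.
rewrite exchange_big; apply: eq_bigr => q _; rewrite mulr_sumr.
by apply: eq_bigr => p _; ring.
Qed.

Lemma ex_le m f g : nonneg m -> (forall x, f x <= g x) -> ex m f <= ex m g.
Proof.
move=> + fg; elim: m => [|p m IH] /=; first by rewrite /ex !big_nil.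
by case/andP=> p0 /IH le; rewrite /ex !big_cons lerD // ler_wpM2l.
Qed.

Lemma ex_const m c : prob m -> ex m (fun=> c) = c.
Proof.
case=> _ E; transitivity (ex m (fun=> 1) * c); last by rewrite E mul1r.
by rewrite /ex mulr_suml; apply: eq_bigr => p _; rewrite mulr1.
Qed.

Lemma ex_ge0 m f : prob m -> (forall x, 0 <= f x) -> 0 <= ex m f.
Proof. by move=> pm f0; rewrite -(ex_const 0 pm) ex_le //; case: pm. Qed.

Lemma ex_le1 m f : prob m -> (forall x, f x <= 1) -> ex m f <= 1.
Proof. by move=> pm f1; rewrite -[leRHS](ex_const 1 pm) ex_le //; case: pm. Qed.

Lemma ex_dist_le m f g h : prob m ->
  (forall x, `|f x - g x| <= h x) -> `|ex m f - ex m g| <= ex m h.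
Proof.
move=> [m0 _] le; rewrite -exB ler_norml; apply/andP; split; last first.
  by apply: ex_le => // x; apply: le_trans (le x); apply: ler_norm.
rewrite lerNl; have -> : - ex m (fun x => f x - g x) = ex m (fun x => g x - f x).
  by rewrite !exB opprB.
by apply: ex_le => // x; apply: le_trans (le x); rewrite distrC; apply: ler_norm.
Qed.

Lemma dprE m (E : pred S) : dpr m E = ex m (fun x => (E x)%:R).
Proof.
rewrite /dpr big_mkcond; apply: eq_bigr => p _.
by case: (E _); rewrite ?mulr1 ?mulr0.
Qed.

Lemma prob_ret (x : S) : prob (dret x).
Proof. by split; rewrite ?ex_ret. Qed.

Lemma prob_bind m (k : S -> dist T) : prob m -> (forall x, prob (k x)) -> prob (dbind m k).
Proof.
move=> pm pk; split; last first.
  by rewrite ex_bind -[RHS](ex_const 1 pm); apply: eq_ex => x; case: (pk x).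
case: pm => + _; elim: m => //= p m IH /andP[p0 /IH nn].
rewrite dbind_cons /nonneg all_cat [X in _ && X]nn andbT all_map.
have [+ _] := pk p.2; apply: sub_all => q /= q0; exact: mulr_ge0.
Qed.

End Expectation.

Lemma prob_map S T (h : S -> T) m : prob m -> prob (dmap h m).
Proof. by move=> pm; apply: prob_bind pm _ => x; apply: prob_ret. Qed.

Lemma prob_tuple T n (f : 'I_n -> dist T) : (forall i, prob (f i)) -> prob (dtuple f).
Proof.
elim: n f => [|n IH] f pf; first exact: prob_ret.
apply: prob_bind => // x; apply: prob_bind => [|s]; first exact: IH.
exact: prob_ret.
Qed.

Lemma prob_uniform (T : finType) : (0 < #|T|)%N -> prob (duniform T).
Proof.
move=> T0; split; first by rewrite /nonneg all_map; apply/allP => x _ /=; rewrite invr_ge0 ler0n.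
rewrite /ex big_map; under eq_bigr => x _ do rewrite mulr1.
by rewrite big_enum sumr_const -[LHS]mulr_natr mulVf // pnatr_eq0 -lt0n.
Qed.

Lemma prob_steps n c : prob (steps n c).
Proof.
have prob_step d : prob (step d).
  case: d => -[|[|c1 c2|x b|x|x|x c0 cf ct|x c'] k] s; try exact: prob_ret.
  by apply: prob_map; split; rewrite /nonneg // /ex /dcoin !big_cons big_nil.
by elim: n c => [|n IH] c; [apply: prob_ret | apply: prob_bind].
Qed.

Lemma prob_eval A ins : prob (eval A ins).
Proof. by apply: prob_map; apply: prob_steps. Qed.

Lemma prob_fix_batch n b s : (0 < n)%N -> prob (@fix_batch n b s).
Proof.
move=> n0; apply: prob_bind => [|u]; last exact: prob_ret.
by apply: prob_tuple => i; apply: prob_uniform; rewrite card_ord.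
Qed.

Lemma ex_tupleS T n (f : 'I_n.+1 -> dist T) F :
  ex (dtuple f) F = ex (f ord0) (fun x =>
    ex (dtuple (fun i => f (lift ord0 i))) (fun s => F [tuple of x :: s])).
Proof.
by rewrite /= ex_bind; apply: eq_ex => x; rewrite ex_bind; apply: eq_ex => s; rewrite ex_ret.
Qed.

Lemma eq_dtuple T n (f g : 'I_n -> dist T) : f =1 g -> dtuple f = dtuple g.
Proof. by move=> /boolp.funext ->. Qed.

Lemma ex_tnth T n (f : 'I_n -> dist T) (i : 'I_n) (h : T -> rat) :
  (forall i, prob (f i)) ->
  ex (dtuple f) (fun x => h (tnth x i)) = ex (f i) h.
Proof.
elim: n f i => [|n IH] f i pf; first by case: i.
rewrite ex_tupleS; case: (unliftP ord0 i) => [j ->|->].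
  rewrite -[RHS](ex_const _ (pf ord0)); apply: eq_ex => x.
  by rewrite -(IH (fun i => f (lift ord0 i)) j) //; apply: eq_ex => s; rewrite tnthS.
apply: eq_ex => x; rewrite -[RHS](ex_const _ (prob_tuple (fun i => pf (lift ord0 i)))).
by apply: eq_ex => s; rewrite tnth0.
Qed.

(** By independence, the second draw at the head can be exchanged with the first draws of the tail.
    This turns a batch of states followed by a batch of queries into independent single messages. *)
Lemma ex_tuple_bind S T U n (f : 'I_n -> dist S) (g : 'I_n -> S -> dist T)
    (h : T -> U) (F : n.-tuple U -> rat) :
  ex (dtuple f) (fun x =>
    ex (dtuple (fun i => g i (tnth x i))) (fun y => F (map_tuple h y))) =
  ex (dtuple (fun i => let* a := f i in dmap h (g i a))) F.
Proof.
elim: n f g F => [|n IH] f g F.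
  by rewrite !ex_ret; congr F; apply: val_inj.
rewrite !ex_tupleS ex_bind; apply: eq_ex => a; rewrite ex_map.
transitivity (ex (g ord0 a) (fun b => ex (dtuple (fun i => f (lift ord0 i))) (fun x =>
    ex (dtuple (fun i => g (lift ord0 i) (tnth x i))) (fun y =>
      F [tuple of h b :: map_tuple h y])))).
  rewrite [RHS]ex_swap; apply: eq_ex => x; rewrite ex_tupleS tnth0; apply: eq_ex => b.
  rewrite (@eq_dtuple _ _ _ (fun i => g (lift ord0 i) (tnth x i))) => [|i]; last by rewrite tnthS.
  by apply: eq_ex => y; congr F; apply: val_inj.
apply: eq_ex => b.
exact: (IH (fun i => f (lift ord0 i)) (fun i => g (lift ord0 i)) (fun y => F [tuple of h b :: y])).
Qed.

(** * Negligible functions *)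

Lemma negligible0 : negligible (fun=> 0).
Proof. by move=> c; exists 0%N => n n0; rewrite normr0 invr_gt0 exprn_gt0 // ltr0n. Qed.

Lemma negligibleD f g : negligible f -> negligible g -> negligible (fun n => f n + g n).
Proof.
(* The exponent [c.+1] leaves a spare factor [1/n], and [1/n + 1/n <= 1] because the maximum with 1
   below forces [n >= 2]. *)
move=> nf ng c; have [n1 h1] := nf c.+1; have [n2 h2] := ng c.+1.
exists (maxn 1 (maxn n1 n2)) => n; rewrite !gtn_max => /and3P[n1' /h1 lef /h2 leg].
apply: le_lt_trans (ler_normD _ _) _; apply: lt_le_trans (ltrD lef leg) _.
have n0 : (0 : rat) < n%:R by rewrite ltr0n; lia.
have inv2 : (n%:R : rat)^-1 <= 2^-1 by rewrite lef_pV2 ?posrE // ler_nat.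
have le1 : (n%:R : rat)^-1 + n%:R^-1 <= 1.
  by move: inv2; move: (n%:R^-1) => y; lra.
by rewrite exprS invfM -mulrDl ler_piMl // invr_ge0 exprn_ge0 // ltW.
Qed.

Lemma negligible_sum (I : Type) (r : seq I) (f : I -> nat -> rat) :
  (forall i, negligible (f i)) -> negligible (fun n => \sum_(i <- r) f i n).
Proof.
move=> nf; elim: r => [|i r IH].
  by move=> c; have [n0 h] := negligible0 c; exists n0 => n /h; rewrite big_nil.
move=> c; have [n0 h] := negligibleD (nf i) IH c.
by exists n0 => n /h; rewrite big_cons.
Qed.

(** The sum of a finite nonnegative family dominates each member; this makes errors uniform in the
    index. *)
Lemma negligible_bound (I : finType) (f : I -> nat -> rat) :
  (forall i n, 0 <= f i n) ->
  (forall i, exists2 eps, negligible eps & forall n, f i n <= eps n) ->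
  exists2 eps, negligible eps & forall i n, f i n <= eps n.
Proof.
move=> f0 ex_eps.
have nf i : negligible (f i).
  have [eps neps le] := ex_eps i => c; have [n0 h] := neps c.
  exists n0 => n /h; apply: le_lt_trans.
  by rewrite !ger0_norm // (le_trans (f0 i n)).
exists (fun n => \sum_(i <- enum I) f i n); first exact: negligible_sum.
move=> i n; rewrite big_enum (bigD1 i) //= lerDl.
by apply: sumr_ge0.
Qed.

(** * The hybrid argument *)

Definition acc (A : ppt) (lam : nat) (v : seq bits) : rat :=
  ex (eval A (unary lam :: v)) (fun s => (s 0%N == [:: true])%:R).

Lemma acc_ge0 A lam v : 0 <= acc A lam v.
Proof. by apply: ex_ge0 => [|s]; [apply: prob_eval | apply: ler0n]. Qed.

Lemma acc_le1 A lam v : acc A lam v <= 1.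
Proof. by apply: ex_le1 => [|s]; [apply: prob_eval | case: eqP]. Qed.

Lemma accept_prE A lam m : accept_pr A lam m = ex m (acc A lam).
Proof. by rewrite /accept_pr dprE ex_bind. Qed.

(** Acceptance looks only at register 0, the one register that [embed_challenge] describes. *)
Lemma acc_output A lam v :
  acc A lam v = ex (dmap (fun s : store => s 0%N) (eval A (unary lam :: v)))
                   (fun b => (b == [:: true])%:R).
Proof. by rewrite ex_map. Qed.

Lemma ex_messages_cat s1 s2 lam F :
  ex (messages (s1 ++ s2) lam) F =
  ex (messages s1 lam) (fun u => ex (messages s2 lam) (fun v => F (u ++ v))).
Proof.
elim: s1 F => [|sg s1 IH] F /=; first by rewrite ex_ret.
by rewrite ex_bind [RHS]ex_bind; apply: eq_ex => q; rewrite !ex_map IH.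
Qed.

(** By independence the message to be exchanged can be drawn ahead of the others and inserted
    afterwards, which is the shape of [embed_challenge]. *)
Lemma ex_messages_insert s1 sg s2 lam F :
  ex (messages (s1 ++ sg :: s2) lam) F =
  ex (message sg lam) (fun q => ex (messages (s1 ++ s2) lam)
    (fun qs => F (take (size s1) qs ++ q :: drop (size s1) qs))).
Proof.
elim: s1 F => [|sg1 s1 IH] F /=.
  rewrite ex_bind; apply: eq_ex => q; rewrite ex_map.
  by apply: eq_ex => qs; rewrite take0 drop0.
rewrite ex_bind; under eq_ex => q1 do rewrite ex_map IH.
rewrite ex_swap; apply: eq_ex => q; rewrite ex_bind.
by apply: eq_ex => q1; rewrite ex_map.
Qed.

Definition close (m m' : nat -> dist (seq bits)) : Prop :=
  forall A : ppt, exists2 eps, negligible eps & forall lam,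
    `|ex (m lam) (acc A lam) - ex (m' lam) (acc A lam)| <= eps lam.

Definition sampler_close (sg sg' : sampler) : Prop :=
  close (fun lam => dmap (fun q => [:: q]) (message sg lam))
        (fun lam => dmap (fun q => [:: q]) (message sg' lam)).

Lemma close_refl m : close m m.
Proof.
move=> A; exists (fun=> 0); first exact: negligible0.
by move=> lam; rewrite subrr normr0.
Qed.

Lemma close_trans m1 m2 m3 : close m1 m2 -> close m2 m3 -> close m1 m3.
Proof.
move=> c12 c23 A; have [e1 n1 le1] := c12 A; have [e2 n2 le2] := c23 A.
exists (fun lam => e1 lam + e2 lam); first exact: negligibleD.
move=> lam; rewrite (le_trans _ (lerD (le1 lam) (le2 lam))) //.
by rewrite (le_trans _ (ler_normD _ _)) // addrA subrK.
Qed.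

Lemma close_messages_insert s1 sg sg' s2 : sampler_close sg sg' ->
  close (messages (s1 ++ sg :: s2)) (messages (s1 ++ sg' :: s2)).
Proof.
move=> cl A.
have le : (size s1 <= size (s1 ++ s2))%N by rewrite size_cat leq_addr.
have [A' EA'] := embed_challenge A le; have [eps neps epsP] := cl A'.
exists eps => // lam; move: (epsP lam); rewrite !ex_messages_insert !ex_map.
have accE q : acc A' lam [:: q] = ex (messages (s1 ++ s2) lam)
    (fun qs => acc A lam (take (size s1) qs ++ q :: drop (size s1) qs)).
  by rewrite acc_output EA' ex_bind; apply: eq_ex => qs; rewrite acc_output.
by rewrite (eq_ex _ accE) [X in _ - X](eq_ex _ accE).
Qed.

(** The prefix [s1] varies in the induction: it gathers the samplers that have already been
    exchanged. *)
Lemma close_messages s1 s2 s2' : List.Forall2 sampler_close s2 s2' ->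
  close (messages (s1 ++ s2)) (messages (s1 ++ s2')).
Proof.
move=> rel; elim: rel s1 => [|sg sg' l l' cl _ IH] s1; first exact: close_refl.
apply: (close_trans (close_messages_insert s1 l cl)).
by rewrite -!cat_rcons; apply: IH.
Qed.

Lemma Forall2_map T U (R : U -> U -> Prop) (f g : T -> U) l :
  (forall x, R (f x) (g x)) -> List.Forall2 R (map f l) (map g l).
Proof. by move=> Rfg; elim: l => [|x l IH]; constructor. Qed.

(** * PIR queries as samplers, and retrieval errors *)

Definition pir_sampler n (Rec : eqType) (P : pir n Rec) DB (i : 'I_n) : sampler :=
  Sampler (pir_prep P DB) (pir_query P) i.

Section Pir.
Variables (n : nat) (Rec : eqType) (P : pir n Rec) (DB : 'I_n -> Rec).

Lemma query_messageE lam i : query_message P DB lam i = message (pir_sampler P DB i) lam.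
Proof.
rewrite /query_message /prep /query /message dbind_map.
by apply: eq_dbind => u; rewrite dmap_comp.
Qed.

Lemma private_close i j : pir_private P DB ->
  sampler_close (pir_sampler P DB i) (pir_sampler P DB j).
Proof.
move=> priv A; have [eps neps le] := priv i j A; exists eps => // lam.
by move: (le lam); rewrite !accept_prE !query_messageE.
Qed.

Lemma prob_prep lam : prob (prep P DB lam).
Proof. by apply: prob_map; apply: prob_eval. Qed.

Lemma prob_query lam st i : prob (query P lam st i).
Proof. by apply: prob_map; apply: prob_eval. Qed.

Lemma prob_answer lam q : prob (answer P DB lam q).
Proof. by apply: prob_map; apply: prob_eval. Qed.

Lemma prob_decode lam st sec a : prob (decode P lam st sec a).
Proof. by apply: prob_map; apply: prob_eval. Qed.

Definition error lam i : rat := ex (retrieve P DB lam i) (fun r => (r != DB i)%:R).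

Lemma error_ge0 lam i : 0 <= error lam i.
Proof.
apply: ex_ge0 => [|r]; last exact: ler0n.
apply: prob_bind => [|st]; first exact: prob_prep.
apply: prob_bind => [|q]; first exact: prob_query.
apply: prob_bind => [|a]; first exact: prob_answer.
exact: prob_decode.
Qed.

Lemma correct_error : pir_correct P DB ->
  exists2 eps, negligible eps & forall i lam, error lam i <= eps lam.
Proof.
move=> corr; apply: (@negligible_bound _ (fun i lam => error lam i)).
  exact: (fun i lam => error_ge0 lam i).
move=> i; have [eps neps le] := corr i; exists eps => // lam.
have pr : prob (retrieve P DB lam i).
  apply: prob_bind => [|st]; first exact: prob_prep.
  apply: prob_bind => [|q]; first exact: prob_query.
  apply: prob_bind => [|a]; first exact: prob_answer.
  exact: prob_decode.
have -> : error lam i = 1 - dpr (retrieve P DB lam i) (fun r => r == DB i).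
  rewrite dprE -[X in X - _](ex_const 1 pr) -exB; apply: eq_ex => r.
  by case: eqP; rewrite ?subrr ?subr0.
by rewrite lerBlDr addrC -lerBlDr.
Qed.

Lemma ex_dtuple_messages b (r : b.-tuple 'I_n) lam F :
  ex (dtuple (fun i => message (pir_sampler P DB (tnth r i)) lam)) (fun q => F (tval q)) =
  ex (messages [seq pir_sampler P DB (tnth r i) | i <- enum 'I_b] lam) F.
Proof.
elim: b r F => [|b IH] r F; first by rewrite enum_ord0 !ex_ret.
case/tupleP: r => i r; rewrite enum_ordSl ex_tupleS /= ex_bind tnth0.
apply: eq_ex => q; rewrite ex_map -map_comp.
rewrite (eq_map (g := fun i => pir_sampler P DB (tnth r i))) => [|j]; last by rewrite /= tnthS.
rewrite -(IH r (fun s => F (q :: s))).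
by congr (ex _ _); apply: eq_dtuple => j; rewrite tnthS.
Qed.

End Pir.

(** * Real, ideal and simulated views *)

Section Pillar.
Variables (R : realType) (pp : pillar_params R).
Variables (P1 : pir (nrows pp) (index_row pp)) (P2 : pir (ndocs pp) 'rV[R]_(emb_dim pp)).

Definition row_sampler := pir_sampler P1 (@index_db R pp).
Definition doc_sampler := pir_sampler P2 (@emb_db R pp).

Definition batch_samplers (r : (batch1 pp).-tuple 'I_(nrows pp))
    (z : (batch2 pp).-tuple 'I_(ndocs pp)) : seq sampler :=
  [seq row_sampler (tnth r i) | i <- enum 'I_(batch1 pp)] ++
  [seq doc_sampler (tnth z i) | i <- enum 'I_(batch2 pp)].

(* The distribution of the server's view when no retrieval fails, so that the
   second batch depends on the query and the padding alone. *)
Definition ideal_view (lam : nat) (Q : text pp) : dist (seq bits) :=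
  let* r := fix_batch (batch1 pp) (row_indices Q) in
  let* z := fix_batch (batch2 pp) (doc_indices (map_tuple (@index_db R pp) r)) in
  messages (batch_samplers r z) lam.

(** The acceptance probability once the first-round messages and the recovered rows are known. The
    second-round states, independent of the first round, are absorbed into [query_message]. *)
Definition second_round A lam (q1 : (batch1 pp).-tuple bits) (rows : seq (index_row pp)) : rat :=
  ex (fix_batch (batch2 pp) (doc_indices rows)) (fun z =>
    ex (dtuple (fun i => query_message P2 (@emb_db R pp) lam (tnth z i))) (fun q2 =>
      acc A lam (view_bits (q1, q2)))).

Lemma second_round_itv A lam q1 rows : 0 <= second_round A lam q1 rows <= 1.
Proof.
have pz : prob (fix_batch (batch2 pp) (doc_indices rows)).
  by apply: prob_fix_batch; apply: ndocs_gt0.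
have pq z : prob (dtuple (fun i : 'I_(batch2 pp) =>
    query_message P2 (@emb_db R pp) lam (tnth z i))).
  apply: prob_tuple => i; apply: prob_bind => [|st]; first exact: prob_prep.
  by apply: prob_map; apply: prob_query.
apply/andP; split.
  by apply: (ex_ge0 pz) => z; apply: (ex_ge0 (pq z)) => q2; apply: acc_ge0.
by apply: (ex_le1 pz) => z; apply: (ex_le1 (pq z)) => q2; apply: acc_le1.
Qed.

Lemma server_viewE A lam Q :
  accept_pr A lam (dmap (@view_bits R pp) (server_view P1 P2 lam Q)) =
  ex (fix_batch (batch1 pp) (row_indices Q)) (fun r =>
  ex (dtuple (fun _ : 'I_(batch1 pp) => prep P1 (@index_db R pp) lam)) (fun st1 =>
  ex (dtuple (fun i => query P1 lam (tnth st1 i) (tnth r i))) (fun q1 =>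
  ex (dtuple (fun i => answer P1 (@index_db R pp) lam (tnth q1 i).1)) (fun a1 =>
  ex (dtuple (fun i => decode P1 lam (tnth st1 i) (tnth q1 i).2 (tnth a1 i))) (fun rows =>
    second_round A lam (map_tuple fst q1) rows))))).
Proof.
rewrite accept_prE !ex_map /execution ex_bind.
(* The second-round states are moved inwards past each draw of the first round, up to the queries
   that use them. *)
under eq_ex => st1 do (rewrite ex_bind; under eq_ex => st2 do rewrite ex_bind; rewrite ex_swap).
rewrite ex_swap; apply: eq_ex => r; apply: eq_ex => st1.
under eq_ex => st2 do rewrite ex_bind.
rewrite ex_swap; apply: eq_ex => q1.
under eq_ex => st2 do rewrite ex_bind.
rewrite ex_swap; apply: eq_ex => a1.
under eq_ex => st2 do rewrite ex_bind.
rewrite ex_swap; apply: eq_ex => rows.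
under eq_ex => st2 do rewrite ex_bind.
rewrite ex_swap; apply: eq_ex => z.
rewrite /query_message.
rewrite -(ex_tuple_bind _ (fun i st => query P2 lam st (tnth z i)) fst
  (fun q2 => acc A lam (view_bits (map_tuple fst q1, q2)))).
apply: eq_ex => st2; rewrite ex_bind; apply: eq_ex => q2.
(* Second-round answers and embeddings lie outside the view and integrate to one. *)
rewrite ex_bind -[RHS](ex_const _ (prob_tuple
  (fun i => prob_answer P2 (@emb_db R pp) lam (tnth q2 i).1))).
apply: eq_ex => a2.
rewrite ex_bind -[RHS](ex_const _ (prob_tuple
  (fun i => prob_decode P2 lam (tnth st2 i) (tnth q2 i).2 (tnth a2 i)))).
by apply: eq_ex => es; rewrite ex_ret.
Qed.

(** States and queries are kept as separate stages, so that the comparison with the real view can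
    proceed draw by draw. *)
Lemma ideal_viewE A lam Q :
  ex (ideal_view lam Q) (acc A lam) =
  ex (fix_batch (batch1 pp) (row_indices Q)) (fun r =>
  ex (dtuple (fun _ : 'I_(batch1 pp) => prep P1 (@index_db R pp) lam)) (fun st1 =>
  ex (dtuple (fun i => query P1 lam (tnth st1 i) (tnth r i))) (fun q1 =>
    second_round A lam (map_tuple fst q1) (map_tuple (@index_db R pp) r)))).
Proof.
rewrite ex_bind; apply: eq_ex => r; rewrite ex_bind.
rewrite (ex_tuple_bind _ (fun i st => query P1 lam st (tnth r i)) fst
  (fun q1 => second_round A lam q1 (map_tuple (@index_db R pp) r))).
rewrite /second_round [RHS]ex_swap; apply: eq_ex => z.
rewrite ex_messages_cat -ex_dtuple_messages.
rewrite (@eq_dtuple _ _ _ (fun i => query_message P1 (@index_db R pp) lam (tnth r i))) => [|i];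
  last by rewrite query_messageE.
apply: eq_ex => q1; rewrite -ex_dtuple_messages.
rewrite (@eq_dtuple _ _ _ (fun i => query_message P2 (@emb_db R pp) lam (tnth z i))) => [|i];
  last by rewrite query_messageE.
exact: eq_ex.
Qed.

Lemma neq_tuple_le n (T : eqType) (x y : n.-tuple T) :
  ((x != y)%:R : rat) <= \sum_(i < n) (tnth x i != tnth y i)%:R.
Proof.
have [_|/eqP ne] := eqVneq x y; first by apply: sumr_ge0 => i _; apply: ler0n.
have [i nei] : exists i, tnth x i != tnth y i.
  apply/existsP; rewrite -[[exists _, _]]negbK negb_exists; apply/negP => /forallP eq_xy.
  by apply: ne; apply: eq_from_tnth => i; apply/eqP; rewrite -[_ == _]negbK.
by rewrite (bigD1 i) //= nei lerDl sumr_ge0 // => j _; apply: ler0n.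
Qed.

Lemma server_view_ideal A lam Q eps :
  (forall i, error P1 (@index_db R pp) lam i <= eps) ->
  `|accept_pr A lam (dmap (@view_bits R pp) (server_view P1 P2 lam Q))
    - ex (ideal_view lam Q) (acc A lam)| <= eps *+ batch1 pp.
Proof.
move=> le_eps; rewrite server_viewE ideal_viewE.
have pr := prob_fix_batch (batch1 pp) (row_indices Q) (nrows_gt0 pp).
pose st_dist := dtuple (fun _ : 'I_(batch1 pp) => prep P1 (@index_db R pp) lam).
pose q_dist r (st : (batch1 pp).-tuple bits) :=
  dtuple (fun i => query P1 lam (tnth st i) (tnth r i)).
pose a_dist (q : (batch1 pp).-tuple (bits * bits)) :=
  dtuple (fun i => answer P1 (@index_db R pp) lam (tnth q i).1).
pose row_dist (st : (batch1 pp).-tuple bits) (q : (batch1 pp).-tuple (bits * bits))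
    (a : (batch1 pp).-tuple bits) :=
  dtuple (fun i => decode P1 lam (tnth st i) (tnth q i).2 (tnth a i)).
have pst : prob st_dist by apply: prob_tuple => i; apply: prob_prep.
have pq r st : prob (q_dist r st) by apply: prob_tuple => i; apply: prob_query.
have pa q : prob (a_dist q) by apply: prob_tuple => i; apply: prob_answer.
have prow st q a : prob (row_dist st q a) by apply: prob_tuple => i; apply: prob_decode.
rewrite -[leRHS](ex_const _ pr).
apply: (ex_dist_le pr) => r; rewrite -/st_dist.
pose bad (rows : (batch1 pp).-tuple (index_row pp)) (i : 'I_(batch1 pp)) : rat :=
  (tnth rows i != @index_db R pp (tnth r i))%:R.
apply: (@le_trans _ _ (ex st_dist (fun st => ex (q_dist r st) (fun q =>
    ex (a_dist q) (fun a => ex (row_dist st q a) (fun rows => \sum_i bad rows i)))))).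
  apply: (ex_dist_le pst) => st; apply: (ex_dist_le (pq r st)) => q.
  (* The ideal side involves neither answers nor recovered rows; it is written as a constant
     expectation over them. *)
  rewrite -[X in _ - X](ex_const _ (pa q)); apply: (ex_dist_le (pa q)) => a.
  rewrite -[X in _ - X](ex_const _ (prow st q a)).
  apply: (ex_dist_le (prow st q a)) => rows.
  have := neq_tuple_le rows (map_tuple (@index_db R pp) r).
  under eq_bigr => i _ do rewrite tnth_map -/(bad rows i).
  apply: le_trans; have [->|_] := eqVneq rows (map_tuple _ r).
    by rewrite subrr normr0.
  have /andP[x0 x1] := second_round_itv A lam (map_tuple fst q) rows.
  have /andP[y0 y1] := second_round_itv A lam (map_tuple fst q)
    (map_tuple (@index_db R pp) r).
  by apply: (@le_trans _ _ 1) => //; rewrite ler_norml; apply/andP; split; lra.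
under eq_ex => st do (under eq_ex => q do
  (under eq_ex => a do rewrite ex_sum; rewrite ex_sum); rewrite ex_sum).
rewrite ex_sum -[batch1 pp in leRHS]card_ord -sumr_const; apply: ler_sum => i _.
(* The marginal of the batched first round at coordinate [i] is a single run of [retrieve], so the
   expected indicator equals [error]. *)
apply: le_trans (le_eps (tnth r i)); rewrite le_eqVlt; apply/orP; left; apply/eqP.
rewrite /error ex_bind.
rewrite -[RHS](ex_tnth i _ (fun _ => prob_prep P1 (@index_db R pp) lam)); apply: eq_ex => st.
rewrite ex_bind -[RHS](ex_tnth i _ (fun j => prob_query P1 lam (tnth st j) (tnth r j))).
apply: eq_ex => q.
rewrite ex_bind -[RHS](ex_tnth i _ (fun j => prob_answer P1 (@index_db R pp) lam (tnth q j).1)).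
apply: eq_ex => a.
exact: (ex_tnth i _ (fun j => prob_decode P1 lam (tnth st j) (tnth q j).2 (tnth a j))).
Qed.

Lemma close_batch_samplers r z r' z' :
  pir_private P1 (@index_db R pp) -> pir_private P2 (@emb_db R pp) ->
  close (messages (batch_samplers r z)) (messages (batch_samplers r' z')).
Proof.
move=> priv1 priv2; apply: (@close_messages [::]); apply: List.Forall2_app;
  by apply: Forall2_map => i; apply: private_close.
Qed.

Lemma simulated_viewE (S : ppt) lam :
  dmap (@view_bits R pp) (simulated_view pp S lam) =
  dmap (fun s : store => mkseq s (batch1 pp + batch2 pp)) (eval S [:: unary lam]).
Proof.
rewrite dmap_comp; apply: eq_dmap => s.
have tupleE n (f : nat -> bits) : [tuple f i | i < n] = map f (iota 0 n) :> seq bits.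
  by rewrite -val_enum_ord -map_comp.
rewrite /view_bits tupleE (tupleE _ (fun i => s (batch1 pp + i)%N)).
by rewrite /mkseq iotaD map_cat (addnC 0%N) (iotaDl (batch1 pp)) -map_comp.
Qed.

End Pillar.

Theorem theorem2 (R : realType) (pp : pillar_params R)
    (P1 : pir (nrows pp) (index_row pp))
    (P2 : pir (ndocs pp) 'rV[R]_(emb_dim pp)) :
  computationally_private P1 (@index_db R pp) ->
  computationally_private P2 (@emb_db R pp) ->
  secure_semi_honest P1 P2.
Proof.
move=> [corr1 priv1] [_ priv2].
pose r0 := [tuple of nseq (batch1 pp) (Ordinal (nrows_gt0 pp))].
pose z0 := [tuple of nseq (batch2 pp) (Ordinal (ndocs_gt0 pp))].
have [S simS] := messages_samplable (batch_samplers P1 P2 r0 z0); exists S => A.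
have simE lam : accept_pr A lam (dmap (@view_bits R pp) (simulated_view pp S lam)) =
    ex (messages (batch_samplers P1 P2 r0 z0) lam) (acc A lam).
  have sz : size (batch_samplers P1 P2 r0 z0) = (batch1 pp + batch2 pp)%N.
    by rewrite size_cat size_map size_enum_ord size_map size_enum_ord.
  by rewrite accept_prE simulated_viewE -simS sz.
pose gap (rz : (batch1 pp).-tuple 'I_(nrows pp) * (batch2 pp).-tuple 'I_(ndocs pp)) lam :=
  `|ex (messages (batch_samplers P1 P2 rz.1 rz.2) lam) (acc A lam)
    - ex (messages (batch_samplers P1 P2 r0 z0) lam) (acc A lam)|.
(* The error has to be fixed before the query [Q], so it covers all the finitely many pairs of
   batches at once. *)
have [e2 ne2 le2] : exists2 eps, negligible eps & forall rz lam, gap rz lam <= eps lam.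
  apply: negligible_bound => [rz lam|rz]; first exact: normr_ge0.
  by have [eps neps le] := close_batch_samplers rz.1 rz.2 r0 z0 priv1 priv2 A; exists eps.
have [e1 ne1 le1] := correct_error corr1.
exists (fun lam => \sum_(i < batch1 pp) e1 lam + e2 lam).
  by apply: negligibleD ne2; apply: negligible_sum.
move=> Q lam; rewrite simE sumr_const card_ord.
have real_ideal := @server_view_ideal R pp P1 P2 A lam Q (e1 lam) (fun i => le1 i lam).
apply: le_trans (ler_distD (ex (ideal_view P1 P2 lam Q) (acc A lam)) _ _) _.
apply: lerD => //.
have pr := prob_fix_batch (batch1 pp) (row_indices Q) (nrows_gt0 pp).
(* The simulated side does not vary with the batches, so the ideal view can be compared with it for
   each fixed pair and averaged. *)
rewrite ex_bind -[X in _ - X](ex_const _ pr) -[leRHS](ex_const _ pr).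
apply: (ex_dist_le pr) => r.
have pz := prob_fix_batch (batch2 pp)
  (doc_indices (map_tuple (@index_db R pp) r)) (ndocs_gt0 pp).
rewrite ex_bind -[X in _ - X](ex_const _ pz) -[leRHS](ex_const _ pz).
by apply: (ex_dist_le pz) => z; apply: (le2 (r, z)).
Qed.
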